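(* Let $\theta:\mathbb{R}^n\to[-\infty,\infty]$ be a symmetric function that is locally Lipschitz continuous relative to its domain, and let $X\in\mathbf{S}^n$ with $(\theta\circ\lambda)(X)$ finite. Then: (a) If $H\in T_{\mathrm{dom}(\theta\circ\lambda)}(X)$ and $\theta$ is parabolically epi-differentiable at $\lambda(X)$ for $\lambda'(X;H)$, then $\theta\circ\lambda$ is parabolically epi-differentiable at $X$ for $H$, and for all $W\in\mathbf{S}^n$ $$\mathrm{d}^2(\theta\circ\lambda)(X)(H\,|\,W)=\mathrm{d}^2\theta(\lambda(X))\big(\lambda'(X;H)\,|\,\lambda''(X;H,W)\big),$$ $$\mathrm{dom}\,\mathrm{d}^2(\theta\circ\lambda)(X)(H\,|\,\cdot)=T^2_{\mathrm{dom}(\theta\circ\lambda)}(X,H).$$ If moreover $\theta$ is lower semicontinuous and convex, then $W\mapsto\mathrm{d}^2(\theta\circ\lambda)(X)(H\,|\,W)$ is convex. (b) If $\theta\circ\lambda$ is parabolically epi-differentiable at $X$, then $\theta$ is parabolically epi-differentiable at $\lambda(X)$.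
   Context: $\mathbf{S}^n$: real symmetric matrices; $\lambda(X)$: eigenvalues in nonincreasing order; $\theta$ symmetric: $\theta(Px)=\theta(x)$ for permutation matrices $P$. Locally Lipschitz relative to its domain: around every $\bar x\in\mathrm{dom}\,\theta$ there are $\ell,V$ with $|\theta(x)-\theta(y)|\le\ell\|x-y\|$ on $V\cap\mathrm{dom}\,\theta$. Tangent cone $T_C(\bar x)=\{w:\exists t_k\downarrow0,w_k\to w,\bar x+t_kw_k\in C\}$; $T^2_C(\bar x,w)=\{u:\exists t_k\downarrow0,u_k\to u,\bar x+t_kw+\frac12t_k^2u_k\in C\}$. Subderivative $\mathrm{d}f(\bar x)(\bar w)=\liminf_{t\downarrow0,w\to\bar w}\frac{f(\bar x+tw)-f(\bar x)}{t}$. For $w$ with $\mathrm{d}f(\bar x)(w)$ finite, the parabolic subderivative is $\mathrm{d}^2f(\bar x)(w\,|\,z)=\liminf_{t\downarrow0,z'\to z}\frac{f(\bar x+tw+\frac12t^2z')-f(\bar x)-t\,\mathrm{d}f(\bar x)(w)}{\frac12t^2}$. $f$ is parabolically epi-differentiable at $\bar x$ for $w$ if $\{z:\mathrm{d}^2f(\bar x)(w|z)<\infty\}\ne\emptyset$ and for every $z$ and every $t_k\downarrow0$ there is $z_k\to z$ with $\mathrm{d}^2f(\bar x)(w|z)=\lim_k\frac{f(\bar x+t_kw+\frac12t_k^2z_k)-f(\bar x)-t_k\mathrm{d}f(\bar x)(w)}{\frac12t_k^2}$; $f$ is parabolically epi-differentiable at $\bar x$ if this holds for every $w$ with $\mathrm{d}f(\bar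 x)(w)$ finite. $\lambda'(X;H)=\lim_{t\downarrow0}(\lambda(X+tH)-\lambda(X))/t$, $\lambda''(X;H,W)=\lim_{t\downarrow0}\frac{\lambda(X+tH+\frac12t^2W)-\lambda(X)-t\lambda'(X;H)}{\frac12t^2}$ (both exist). *)

(* Defs.v *)
(* R : realType, vectors 'rV[R]_n, matrices 'M[R]_n
   (with MathComp-Analysis' canonical normed-module structure, max-entry norm). *)
From HB Require Import structures.
From mathcomp Require Import all_boot all_order all_fingroup all_algebra.
From mathcomp Require Import all_classical all_reals.
From mathcomp Require Import ereal topology normedtype sequences.
Set Implicit Arguments. Unset Strict Implicit. Unset Printing Implicit Defensive.
Import Order.TTheory GRing.Theory Num.Theory.
Import numFieldNormedType.Exports.
Local Open Scope classical_set_scope.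
Local Open Scope ring_scope.
Local Open Scope ereal_dual_scope.
Local Close Scope ereal_dual_scope.

Section VarAnal.
Variables (R : realType) (E : normedModType R).
(* S : the ambient (linear) space of admissible directions, e.g. setT for R^n,
   the symmetric matrices for S^n *)
Implicit Types (S C : set E) (f : E -> \bar R).

Definition efdom S f : set E := [set x | S x /\ (f x < +oo)%E].

Definition tangent_cone C (x : E) : set E :=
  [set w | exists (tk : nat -> R) (wk : nat -> E),
     (forall k, 0 < tk k) /\ tk @ \oo --> (0 : R) /\ wk @ \oo --> w /\
     forall k, C (x + tk k *: wk k)].

Definition tangent2 C (x w : E) : set E :=
  [set u | exists (tk : nat -> R) (uk : nat -> E),
     (forall k, 0 < tk k) /\ tk @ \oo --> (0 : R) /\ uk @ \oo --> u /\
     forall k, C (x + tk k *: w + (tk k ^+ 2 / 2) *: uk k)].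

Definition subderiv S f (x w0 : E) : \bar R :=
  ereal_sup [set ereal_inf
     [set y | exists (t : R) (w : E), 0 < t < d /\ `|w - w0| < d /\ S w /\
                y = ((f (x + t *: w)%R - f x) * (t^-1)%:E)%E] | d in [set d : R | 0 < d]].

Definition para_quot S f (x w z : E) (t : R) : \bar R :=
  ((f (x + t *: w + (t ^+ 2 / 2) *: z)%R - f x - t%:E * subderiv S f x w)
     * ((t ^+ 2 / 2)^-1)%:E)%E.

Definition para_subderiv S f (x w z0 : E) : \bar R :=
  ereal_sup [set ereal_inf
     [set y | exists (t : R) (z : E), 0 < t < d /\ `|z - z0| < d /\ S z /\
                y = para_quot S f x w z t] | d in [set d : R | 0 < d]].

(* parabolic epi-differentiability at x for w (only meaningful, and required,
   when d f(x)(w) is finite) *)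
Definition para_epi_for S f (x w : E) : Prop :=
  subderiv S f x w \is a fin_num /\
  (exists z, S z /\ (para_subderiv S f x w z < +oo)%E) /\
  forall z, S z -> forall tk : nat -> R, (forall k, 0 < tk k) -> tk @ \oo --> (0 : R) ->
    exists zk : nat -> E, (forall k, S (zk k)) /\ zk @ \oo --> z /\
      (fun k => para_quot S f x w (zk k) (tk k)) @ \oo --> para_subderiv S f x w z.

Definition para_epi S f (x : E) : Prop :=
  forall w, S w -> subderiv S f x w \is a fin_num -> para_epi_for S f x w.

Definition loc_lip_rel_dom S f : Prop :=
  forall x0, efdom S f x0 -> exists (l d : R), 0 < d /\
    forall x y, efdom S f x -> efdom S f y -> `|x - x0| < d -> `|y - x0| < d ->
      (`|f x - f y| <= (l * `|x - y|)%:E)%E.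

Definition lsc f : Prop :=
  forall x (a : R), (a%:E < f x)%E -> exists d : R, 0 < d /\
    forall y, `|y - x| < d -> (a%:E < f y)%E.

(* convexity of an extended-real-valued function on S (convex epigraph) *)
Definition convex_on S f : Prop :=
  forall a b, S a -> S b -> forall m : R, 0 < m < 1 ->
    forall al be : R, (f a <= al%:E)%E -> (f b <= be%:E)%E ->
      (f (m *: a + (1 - m) *: b)%R <= (m * al + (1 - m) * be)%R%:E)%E.
End VarAnal.

Section Eig.
Variables (R : realType) (n : nat).

Definition symmx (X : 'M[R]_n) : Prop := X^T = X.

Definition sym_fun (theta : 'rV[R]_n -> \bar R) : Prop :=
  forall (s : 'S_n) (x : 'rV[R]_n), theta (x *m perm_mx s) = theta x.

Definition nonincr (d : 'rV[R]_n) : Prop :=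
  forall i j : 'I_n, (i <= j)%N -> d 0 j <= d 0 i.

Definition is_eigvals (X : 'M[R]_n) (d : 'rV[R]_n) : Prop :=
  nonincr d /\ exists U : 'M[R]_n, U *m U^T = 1%:M /\ X = U *m diag_mx d *m U^T.

(* lambda(X) (only used for symmetric X, for which it is uniquely determined) *)
Definition eigvals (X : 'M[R]_n) : 'rV[R]_n :=
  match pselect (exists d, is_eigvals X d) with
  | left h => projT1 (cid h)
  | right _ => 0
  end.

Definition eig_d1 (X H : 'M[R]_n) : 'rV[R]_n :=
  lim ((fun t : R => t^-1 *: (eigvals (X + t *: H) - eigvals X)) @ 0^'+).

Definition eig_d2 (X H W : 'M[R]_n) : 'rV[R]_n :=
  lim ((fun t : R => (t ^+ 2 / 2)^-1 *:
     (eigvals (X + t *: H + (t ^+ 2 / 2) *: W) - eigvals X - t *: eig_d1 X H)) @ 0^'+).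
End Eig.

(* Main.v *)
(** A point [x] near [eigvals X] lifts to a matrix near [X] with the same value:
    if [Y = U diag(eigvals Y) U^T] then [U diag(x) U^T] is as close to [Y] as [x]
    is to [eigvals Y], and [theta \o eigvals] takes there the value [theta x] by
    symmetry.  Conversely [eigvals] is Lipschitz.  Hence, as soon as
    [eigvals (X + t H + t^2/2 W) = eigvals X + t l1 + t^2/2 l2 + O(t^3)], the
    difference quotients of [theta \o eigvals] near [W] and those of [theta] near
    [l2] take the same values, so subderivatives, parabolic subderivatives and
    recovery sequences transfer in both directions.

    For the expansion, write [H = B + [K, X]] with [B] symmetric commuting with
    [X] and [K] skew, and iterate once more relatively to [X] and [B]: this gives
    skew matrices [A], [L] such that [P = 1 + t A + t^2 (A^2/2 + L)] is orthogonal
    up to [O(t^3)] and [P^T (X + t H + t^2/2 W) P = X + t B + t^2 C + O(t^3)] with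
    [X], [B], [C] symmetric and commuting.  These are diagonalised simultaneously,
    and a Courant-Fischer argument tolerating the error in [P^T P = 1] compares the
    eigenvalues.  Sorting the three diagonals lexicographically makes the limit
    diagonal nonincreasing for all small [t > 0].

    Convexity in [W] reduces to that of [theta \o eigvals] (Davis): by Ky Fan's
    inequality the eigenvalues of a convex combination are majorized by the convex
    combination of the eigenvalues, and T-transforms carry the bound over. *)
Require Import Defs.
From HB Require Import structures.
From mathcomp Require Import all_boot all_order all_fingroup all_algebra.
From mathcomp Require Import all_classical all_reals.
From mathcomp Require Import ereal topology normedtype sequences.
From mathcomp Require Import derive ring lra.
Set Implicit Arguments. Unset Strict Implicit. Unset Printing Implicit Defensive.
Import Order.TTheory GRing.Theory Num.Theory.
Import numFieldNormedType.Exports.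
Local Open Scope classical_set_scope.
Local Open Scope ring_scope.

(** * Norm estimates for products and orthogonal conjugations *)

Section MatrixNorm.
Variable R : realType.

Lemma mx_entry_le m n (A : 'M[R]_(m, n)) i j : `|A i j| <= `|A|.
Proof.
rewrite [`|A|]mx_normrE.
exact: (le_bigmax _ (fun ij : (('I_m * 'I_n)%type) => `|A ij.1 ij.2|) (i, j)).
Qed.

Lemma mx_norm_leP m n (A : 'M[R]_(m, n)) c :
  0 <= c -> (forall i j, `|A i j| <= c) -> `|A| <= c.
Proof.
move=> c0 Ac; rewrite [`|A|]mx_normrE; exact/bigmax_leP.
Qed.

Lemma mx_norm_tr m n (A : 'M[R]_(m, n)) : `|A^T| = `|A|.
Proof.
apply/eqP; rewrite eq_le; apply/andP; split; apply: mx_norm_leP => // i j.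
  by rewrite mxE mx_entry_le.
by have := mx_entry_le A^T j i; rewrite mxE.
Qed.

Lemma mx_norm_mul m n p (A : 'M[R]_(m, n)) (B : 'M[R]_(n, p)) :
  `|A *m B| <= n%:R * `|A| * `|B|.
Proof.
apply: mx_norm_leP => [|i j]; first by rewrite !mulr_ge0.
rewrite mxE (le_trans (ler_norm_sum _ _ _)) //.
have -> : n%:R * `|A| * `|B| = \sum_(k < n) (`|A| * `|B|).
  by rewrite sumr_const card_ord -mulrA mulr_natl.
by apply: ler_sum => k _; rewrite normrM ler_pM // mx_entry_le.
Qed.

Lemma mx_norm_diag n (d : 'rV[R]_n) : `|diag_mx d| <= `|d|.
Proof.
apply: mx_norm_leP => // i j; rewrite mxE.
case: eqP => [->|_]; last by rewrite normr0.
by rewrite mulr1n mx_entry_le.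
Qed.

Lemma orthogonal_norm n (U : 'M[R]_n) : U *m U^T = 1%:M -> `|U| <= 1.
Proof.
move=> UU; apply: mx_norm_leP => // i j.
have /matrixP/(_ i i) := UU; rewrite !mxE eqxx mulr1n => E.
have : U i j ^+ 2 <= 1.
  rewrite -E (bigD1 j) //= mxE -expr2 lerDl sumr_ge0 // => k _.
  by rewrite mxE -expr2 sqr_ge0.
by rewrite -real_normK ?num_real // -[X in _ <= X](expr1n _ 2) ler_pXn2r // nnegrE.
Qed.

(** The norm is the largest entry, submultiplicative only up to a factor [n] per product, whence
    [n%:R ^+ 2]. *)
Lemma orthogonal_conj_norm n (U A : 'M[R]_n) : U *m U^T = 1%:M ->
  `|U *m A *m U^T| <= n%:R ^+ 2 * `|A|.
Proof.
move=> UU; have U1 := orthogonal_norm UU.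
apply: le_trans (mx_norm_mul _ _) _.
apply: (@le_trans _ _ (n%:R * (n%:R * `|U| * `|A|) * `|U^T|)).
  by rewrite ler_wpM2r // ler_wpM2l // mx_norm_mul.
rewrite mx_norm_tr.
have -> : n%:R * (n%:R * `|U| * `|A|) * `|U| = n%:R ^+ 2 * `|A| * (`|U| * `|U|).
  ring.
by rewrite ler_piMr ?mulr_ge0 // mulr_ile1.
Qed.
End MatrixNorm.

(** * Quadratic forms, Courant-Fischer comparison, uniqueness of ordered eigenvalues *)

Section QuadraticForm.
Variables (R : realType) (n : nat).
Implicit Types (y z : 'cV[R]_n) (E : 'M[R]_n).

Definition qform E y : R := (y^T *m E *m y) 0 0.

Lemma qformE E y : qform E y = \sum_i \sum_j y i 0 * E i j * y j 0.
Proof.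
rewrite /qform mxE exchange_big /=; apply: eq_bigr => j _.
rewrite mxE mulr_suml; apply: eq_bigr => i _; by rewrite mxE.
Qed.

Lemma qform1E y : qform 1%:M y = \sum_i y i 0 ^+ 2.
Proof. by rewrite /qform mulmx1 mxE; apply: eq_bigr => i _; rewrite mxE expr2. Qed.

Lemma qform_diagE (d : 'rV[R]_n) y : qform (diag_mx d) y = \sum_i d 0 i * y i 0 ^+ 2.
Proof.
rewrite /qform mxE; apply: eq_bigr => i _.
by rewrite mul_mx_diag !mxE; ring.
Qed.

Lemma qformB E F y : qform (E - F) y = qform E y - qform F y.
Proof. by rewrite /qform mulmxBr mulmxBl !mxE. Qed.

Lemma qform_conj E (P : 'M[R]_n) y : qform (P^T *m E *m P) y = qform E (P *m y).
Proof. by rewrite /qform trmx_mul !mulmxA. Qed.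

(** Each term is at most [e * (y_i^2 + y_j^2) / 2] by the arithmetic-geometric inequality; summing
    over both indices counts every square [n] times. *)
Lemma qform_bound E y e : `|E| <= e ->
  `|qform E y| <= n%:R * e * qform 1%:M y.
Proof.
move=> Ee; have e0 : 0 <= e by apply: le_trans Ee.
rewrite qformE (le_trans (ler_norm_sum _ _ _)) //.
have amgm (a b : R) : `|a| * `|b| <= (a ^+ 2 + b ^+ 2) / 2.
  have := sqr_ge0 (`|a| - `|b|); rewrite sqrrB !real_normK ?num_real //; lra.
apply: (@le_trans _ _ (\sum_i \sum_j e * ((y i 0 ^+ 2 + y j 0 ^+ 2) / 2))).
  apply: ler_sum => i _; rewrite (le_trans (ler_norm_sum _ _ _)) //.
  apply: ler_sum => j _; rewrite !normrM mulrAC mulrC ler_pM ?mulr_ge0 //.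
  exact: le_trans (mx_entry_le _ _ _) Ee.
rewrite qform1E.
under eq_bigr => i _ do rewrite -mulr_sumr -mulr_suml big_split /= sumr_const card_ord.
rewrite -mulr_sumr -mulr_suml big_split /= sumr_const card_ord.
rewrite sumrMnl; set S := \sum_(i < n) _; rewrite -[S *+ n]mulr_natl.
have -> : e * ((n%:R * S + n%:R * S) / 2) = n%:R * e * S by field.
exact: lexx.
Qed.

Lemma qform1_gt0 y : y != 0 -> 0 < qform 1%:M y.
Proof.
move=> y0; rewrite qform1E lt_def sumr_ge0 ?andbT; last by move=> i _; rewrite sqr_ge0.
apply: contra y0 => /eqP s0; apply/eqP/matrixP => i j; rewrite ord1 mxE.
move/psumr_eq0P: s0 => /(_ (fun i _ => sqr_ge0 _) i isT) /eqP.
by rewrite sqrf_eq0 => /eqP.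
Qed.

(** A linear system with fewer equations ([K]) than unknowns ([I]) has a nonzero solution. This
    replaces the intersection of subspaces in the Courant-Fischer principle. *)
Lemma solve_supported (T : 'M[R]_n) (I K : {set 'I_n}) : (#|K| < #|I|)%N ->
  exists y : 'cV[R]_n, [/\ y != 0, forall j, j \notin I -> y j 0 = 0 &
    forall k, k \in K -> (T *m y) k 0 = 0].
Proof.
move=> KI.
pose M : 'M[R]_(#|I|, #|K|) := \matrix_(a, b) T (enum_val b) (enum_val a).
have kM : kermx M != 0.
  rewrite -mxrank_eq0 -lt0n mxrank_ker subn_gt0.
  exact: leq_ltn_trans (rank_leq_col _) KI.
pose u := nz_row (kermx M).
have uM : u *m M = 0.
  by apply/eqP; rewrite -sub_kermx; exact: nz_row_sub.
have u0 : u != 0 by rewrite nz_row_eq0.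
pose y : 'cV[R]_n := \col_j \sum_(a < #|I|) u 0 a *+ (enum_val a == j).
have yE a : y (enum_val a) 0 = u 0 a.
  rewrite mxE (bigD1 a) //= eqxx mulr1n big1 ?addr0 // => b ba.
  by rewrite (inj_eq enum_val_inj) (negPf ba).
exists y; split.
- apply: contra u0 => /eqP y0; apply/eqP/matrixP => i a.
  by rewrite ord1 -yE y0 !mxE.
- move=> j jI; rewrite mxE big1 // => a _.
  by case: eqP => // aj; move: jI; rewrite -aj enum_valP.
- move=> k kK; move/matrixP: uM => /(_ 0 (enum_rank_in kK k)); rewrite !mxE => E.
  rewrite -[RHS]E.
  under eq_bigr => j _ do rewrite mxE mulr_sumr.
  rewrite exchange_big /=; apply: eq_bigr => a _.
  rewrite (bigD1 (enum_val a)) //= eqxx mulr1n big1 ?addr0 => [|j ja].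
    by rewrite mxE (enum_rankK_in kK) // mulrC.
  by rewrite eq_sym (negPf ja) mulr0.
Qed.

(* Courant-Fischer comparison for an approximately orthogonal [P] that
   approximately diagonalises [A]. *)
Lemma quasi_diag_compare (A P U : 'M[R]_n) (d l : 'rV[R]_n) (I K : {set 'I_n}) e1 e2 b c :
  A = U *m diag_mx l *m U^T -> U *m U^T = 1%:M ->
  (#|K| < #|I|)%N ->
  `|P^T *m P - 1%:M| <= e1 -> `|P^T *m A *m P - diag_mx d| <= e2 ->
  (forall i, i \in I -> c <= d 0 i) -> (forall i, i \notin K -> l 0 i <= b) ->
  c <= b + n%:R * (e2 + e1 * `|b|).
Proof.
move=> AE UU KI P1 PA cd lb.
(* Support in [I] keeps the form of [diag_mx d] above [c] times the squared length, while
   [U^T *m P *m y] avoids the eigenvalues indexed by [K], so the form of [A] at [P *m y] is at most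
   [b] times the squared length there. *)
have [y [y0 yI yK]] := solve_supported (U^T *m P) KI.
have s0 := qform1_gt0 y0.
have B1 := qform_bound y P1; have B2 := qform_bound y PA.
set s := qform 1%:M y in s0 B1 B2 *.
rewrite qformB qform_conj AE in B2; rewrite qformB in B1.
have EP : qform (P^T *m P) y = qform 1%:M (U^T *m P *m y).
  rewrite -qform_conj; congr (qform _ y).
  by rewrite mulmx1 trmx_mul trmxK mulmxA -[P^T *m U *m _]mulmxA UU mulmx1.
have EA : qform (U *m diag_mx l *m U^T) (P *m y) = qform (diag_mx l) (U^T *m P *m y).
  by rewrite /qform !trmx_mul trmxK !mulmxA.
have H1 : qform (diag_mx l) (U^T *m P *m y) <= b * qform 1%:M (U^T *m P *m y).
  rewrite qform_diagE qform1E mulr_sumr; apply: ler_sum => i _.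
  have [iK|iK] := boolP (i \in K); first by rewrite yK // expr0n /= !mulr0.
  by rewrite ler_wpM2r ?sqr_ge0 // lb.
have H2 : c * s <= qform (diag_mx d) y.
  rewrite /s qform_diagE qform1E mulr_sumr; apply: ler_sum => i _.
  have [iI|iI] := boolP (i \in I); last by rewrite yI // expr0n /= !mulr0.
  by rewrite ler_wpM2r ?sqr_ge0 // cd.
rewrite EA in B2; rewrite EP in B1.
rewrite -/s in B1.
set q := qform 1%:M _ in B1 H1; set p := qform (diag_mx l) _ in B2 H1.
(* The squared lengths of [y] and [P *m y] differ by at most [n%:R * e1 * s]; [b] may be negative,
   hence [|b|]. *)
have H3 : b * (q - s) <= `|b| * (n%:R * e1 * s).
  apply: le_trans (ler_norm _) _; rewrite normrM; exact: ler_wpM2l.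
rewrite -(ler_pM2r s0).
move: B2; rewrite ler_norml => /andP[B2 _].
nra.
Qed.

Lemma eig_quasi_diag (A P : 'M[R]_n) (d l : 'rV[R]_n) e1 e2 :
  is_eigvals A l -> nonincr d ->
  `|P^T *m P - 1%:M| <= e1 -> `|P^T *m A *m P - diag_mx d| <= e2 ->
  forall i, `|l 0 i - d 0 i| <= n%:R * (e2 + e1 * `|l 0 i|).
Proof.
move=> [ln [U [UU AE]]] dn P1 PA i.
(* The [i + 1] leading coordinates against the [i] leading eigenvalues: one unknown more than
   equations. *)
have L : d 0 i <= l 0 i + n%:R * (e2 + e1 * `|l 0 i|).
  apply: (quasi_diag_compare (I := [set j : 'I_n | (j <= i)%N])
    (K := [set j : 'I_n | (j < i)%N]) AE UU _ P1 PA).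
  - apply: proper_card; apply/properP; split.
      by apply/fintype.subsetP => j; rewrite !inE => /ltnW.
    by exists i; rewrite !inE ?ltnn ?leqnn.
  - by move=> j; rewrite inE => /dn.
  - by move=> j; rewrite inE -leqNgt => /ln.
have dN (u : 'rV[R]_n) : diag_mx (- u) = - diag_mx u by exact: raddfN.
(* The reverse bound is the same comparison for [- A], with trailing index sets. *)
have L' : - d 0 i <= - l 0 i + n%:R * (e2 + e1 * `|- l 0 i|).
  apply: (@quasi_diag_compare (- A) P U (- d) (- l) [set j : 'I_n | (i <= j)%N]
    [set j : 'I_n | (i < j)%N]) => //.
  - by rewrite AE dN mulmxN mulNmx.
  - apply: proper_card; apply/properP; split.
      by apply/fintype.subsetP => j; rewrite !inE => /ltnW.
    by exists i; rewrite !inE ?ltnn ?leqnn.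
  - by rewrite dN mulmxN mulNmx -opprD normrN.
  - by move=> j; rewrite inE => ij; rewrite mxE lerN2 dn.
  - by move=> j; rewrite inE -leqNgt => ij; rewrite mxE lerN2 ln.
rewrite normrN in L'.
by rewrite ler_norml; apply/andP; split; lra.
Qed.

Lemma is_eigvals_uniq (A : 'M[R]_n) (d l : 'rV[R]_n) :
  is_eigvals A l -> is_eigvals A d -> l = d.
Proof.
move=> lA [dn [U [UU AE]]]; apply/rowP => i.
have UU' := mulmx1C UU.
have := @eig_quasi_diag A U d l 0 0 lA dn.
have -> : U^T *m A *m U = diag_mx d.
  by rewrite AE !mulmxA UU' mul1mx -mulmxA UU' mulmx1.
rewrite UU' !subrr normr0 => /(_ (lexx _) (lexx _) i).
by rewrite mul0r addr0 mulr0 normr_le0 subr_eq0 => /eqP.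
Qed.
End QuadraticForm.

Lemma continuous_fin_sum (R : realType) (T : topologicalType) (I : finType) (f : I -> T -> R) :
  (forall i, continuous (f i)) -> continuous (fun x => \sum_i f i x : R).
Proof.
move=> fc; elim: (index_enum I) => [|i s IH].
  have -> : (fun x => \sum_(i <- [::]) f i x) = (fun=> 0).
    by apply/funext => x; rewrite big_nil.
  exact: cst_continuous.
have -> : (fun x => \sum_(j <- i :: s) f j x) =
    (fun x => f i x + \sum_(j <- s) f j x).
  by apply/funext => x; rewrite big_cons.
by move=> x; apply: continuousD; [exact: fc | exact: IH].
Qed.

Lemma mxDE (V : nmodType) m n (A B : 'M[V]_(m, n)) i j : (A + B) i j = A i j + B i j.
Proof. by rewrite mxE. Qed.

Lemma mxNE (V : zmodType) m n (A : 'M[V]_(m, n)) i j : (- A) i j = - A i j.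
Proof. by rewrite mxE. Qed.

Lemma mxZE (R : pzRingType) m n (a : R) (A : 'M[R]_(m, n)) i j :
  (a *: A) i j = a * A i j.
Proof. by rewrite mxE. Qed.

Lemma trmx_scale (R : pzRingType) m n (a : R) (A : 'M[R]_(m, n)) : (a *: A)^T = a *: A^T.
Proof. by apply/matrixP => i j; rewrite !mxE. Qed.

Lemma trmx_add (V : nmodType) m n (A B : 'M[V]_(m, n)) : (A + B)^T = A^T + B^T.
Proof. by apply/matrixP => i j; rewrite !mxE. Qed.

Lemma trmx_opp (V : zmodType) m n (A : 'M[V]_(m, n)) : (- A)^T = - A^T.
Proof. by apply/matrixP => i j; rewrite !mxE. Qed.

(** * Simultaneous diagonalisation of commuting symmetric matrices *)

Section SimultaneousDiagonalization.
Variables (R : realType) (n : nat).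
Implicit Types (A : 'M[R]_n) (x v : 'rV[R]_n).

Lemma qform_continuous A : continuous (fun x => qform A x^T).
Proof.
have -> : (fun x => qform A x^T) =
    (fun x => \sum_i \sum_j x 0 i * A i j * x 0 j).
  by apply/funext => x; rewrite qformE; do 2 apply: eq_bigr => ? _; rewrite !mxE.
apply: continuous_fin_sum => i; apply: continuous_fin_sum => j x.
have cc k : {for x, continuous (fun y : 'rV[R]_n => y 0 k)}.
  exact: coord_continuous.
have cA : {for x, continuous (fun y : 'rV[R]_n => A i j)} by exact: cst_continuous.
exact: (continuousM (continuousM (cc i) cA) (cc j)).
Qed.

Lemma qformZ A (a : R) (y : 'cV[R]_n) : qform A (a *: y) = a ^+ 2 * qform A y.
Proof. by rewrite /qform trmx_scale -scalemxAr -!scalemxAl scalerA !mxE expr2. Qed.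

Lemma qformD A (y z : 'cV[R]_n) : A^T = A ->
  qform A (y + z) = qform A y + 2 * (y^T *m A *m z) 0 0 + qform A z.
Proof.
move=> AA; rewrite /qform trmx_add !(mulmxDl, mulmxDr).
have E : (z^T *m A *m y) 0 0 = (y^T *m A *m z) 0 0.
  have -> : z^T *m A *m y = (y^T *m A *m z)^T by rewrite !trmx_mul trmxK AA mulmxA.
  by rewrite mxE.
by rewrite !mxDE E; ring.
Qed.

Lemma qform1_eq0 (y : 'cV[R]_n) : qform 1%:M y = 0 -> y = 0.
Proof.
move=> y0; apply/eqP; apply: contraT => /qform1_gt0.
by rewrite y0 ltxx.
Qed.

(** The form is the squared length of [x *m Z]; this turns membership in a subspace into a closed
    scalar condition. *)
Lemma qform_gram m (Z : 'M[R]_(n, m)) x : qform (Z *m Z^T) x^T = 0 -> x *m Z = 0.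
Proof.
move=> H; have : \sum_j ((x *m Z) 0 j) ^+ 2 = 0.
  rewrite -[RHS]H /qform trmxK mulmxA -mulmxA -trmx_mul mxE.
  by apply: eq_bigr => j _; rewrite [(_^T) j 0]mxE expr2.
move=> /psumr_eq0P => /(_ (fun i _ => sqr_ge0 _)) H0.
by apply/matrixP => i j; rewrite ord1 [RHS]mxE; apply/eqP; rewrite -sqrf_eq0 H0.
Qed.

(* An eigenvector is a maximiser of the quadratic form on the unit sphere of
   the invariant subspace [{x | x *m Z = 0}]. *)
Lemma sym_eigenvector m A (Z : 'M[R]_(n, m)) x :
  A^T = A -> (forall y : 'rV[R]_n, y *m Z = 0 -> y *m A *m Z = 0) ->
  x != 0 -> x *m Z = 0 ->
  exists v (a : R), [/\ v != 0, v *m Z = 0 & v *m A = a *: v].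
Proof.
move=> AA AZ x0 xZ.
pose S : set 'rV[R]_n := [set y | qform 1%:M y^T = 1 /\ qform (Z *m Z^T) y^T = 0].
have gramZ (y : 'rV[R]_n) : y *m Z = 0 -> qform (Z *m Z^T) y^T = 0.
  by move=> yZ; rewrite /qform trmxK mulmxA yZ !mul0mx mxE.
have normalize (y : 'rV[R]_n) : y != 0 -> y *m Z = 0 ->
    S ((Num.sqrt (qform 1%:M y^T))^-1 *: y).
  move=> y0 yZ; have q0 : 0 < qform 1%:M y^T by rewrite qform1_gt0 // trmx_eq0.
  split; last by apply: gramZ; rewrite -scalemxAl yZ scaler0.
  by rewrite trmx_scale qformZ exprVn (sqr_sqrtr (ltW q0)) mulVf // gt_eqF.
have S0 : S !=set0 by eexists; exact: normalize x0 xZ.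
have cS : compact S.
  apply: bounded_closed_compact.
    exists 1; split; first exact: num_real.
    move=> b b1 y [y1 _]; apply: (le_trans _ (ltW b1)).
    apply: mx_norm_leP => // i j; rewrite ord1.
    have : y 0 j ^+ 2 <= 1.
      rewrite -y1 qform1E (bigD1 j) //= mxE lerDl sumr_ge0 // => k _.
      by rewrite mxE sqr_ge0.
    by rewrite -real_normK ?num_real // -[X in _ <= X](expr1n _ 2) ler_pXn2r // nnegrE.
  have cq B c : closed [set y : 'rV[R]_n | qform B y^T = c].
    apply: (@closed_comp _ _ (fun y : 'rV[R]_n => qform B y^T) [set c]).
      by move=> y _; exact: qform_continuous.
    exact: closed_eq.
  by apply: closedI; exact: cq.
have [v + vmax] := EVT_max_rV S0 cS (continuous_subspaceT (@qform_continuous A)).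
rewrite inE => -[v1 /qform_gram vZ].
set a := qform A v^T in vmax.
exists v, a; split=> //.
  by apply/eqP => v0; move/eqP: v1; rewrite v0 /qform trmxK !mul0mx mxE eq_sym oner_eq0.
(* Maximality makes [M] positive semidefinite on the subspace and zero at [v]; testing its form
   along [v + s *: u] with [u = v *m M] then forces [u = 0]. *)
pose M := a%:M - A.
have MM : M^T = M by rewrite /M trmx_add trmx_opp tr_scalar_mx AA.
have qM (y : 'cV[R]_n) : qform M y = a * qform 1%:M y - qform A y.
  rewrite qformB; congr (_ - _); rewrite /qform -[a%:M]scalemx1.
  by rewrite -scalemxAr -scalemxAl mxE.
have Mge0 (y : 'rV[R]_n) : y *m Z = 0 -> 0 <= qform M y^T.
  move=> yZ; have [->|y0] := eqVneq y 0; first by rewrite /qform trmx0 !mulmx0 mxE.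
  have q0 : 0 < qform 1%:M y^T by rewrite qform1_gt0 // trmx_eq0.
  have := vmax _ (mem_set (normalize _ y0 yZ)).
  rewrite trmx_scale qformZ exprVn (sqr_sqrtr (ltW q0)) => /= H.
  by rewrite qM subr_ge0 -ler_pdivrMr // mulrC.
have Mv : qform M v^T = 0 by rewrite qM v1 mulr1 subrr.
pose u := v *m M.
have uZ : u *m Z = 0.
  by rewrite /u /M mulmxBr mulmxBl AZ // mul_mx_scalar -scalemxAl vZ scaler0 subrr.
have H (s : R) : 0 <= 2 * s * qform 1%:M u^T + s ^+ 2 * qform M u^T.
  have := Mge0 (v + s *: u); rewrite mulmxDl -scalemxAl vZ uZ scaler0 addr0.
  move=> /(_ erefl); rewrite trmx_add qformD // Mv add0r trmx_scale qformZ.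
  have -> : ((v^T)^T *m M *m (s *: u^T)) 0 0 = s * qform 1%:M u^T.
    by rewrite trmxK -scalemxAr mxE /qform trmxK mulmx1.
  by rewrite mulrA.
have q0 : 0 <= qform 1%:M u^T.
  by rewrite qform1E; apply: sumr_ge0 => i _; rewrite sqr_ge0.
have q1 : 0 <= qform M u^T by exact: Mge0.
have u0 : qform 1%:M u^T = 0.
  apply/eqP; rewrite eq_le q0 andbT.
  set q := qform 1%:M u^T in q0 H *; set p := qform M u^T in q1 H.
  (* The minimiser would be [- q / p], but [p] may vanish; with [w = q / (p + 1)] the bound reads
     [0 <= - w ^+ 2 * (p + 2)]. *)
  have := H (- (q / (p + 1))).
  have p1 : 0 < p + 1 by lra.
  set w := q / (p + 1); have qE : q = w * (p + 1) by rewrite /w mulfVK ?gt_eqF.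
  have w0 : 0 <= w by rewrite /w divr_ge0 // ltW.
  rewrite qE => HH; have : w ^+ 2 <= 0 by nra.
  move=> w2; have : w ^+ 2 == 0 by rewrite eq_le w2 sqr_ge0.
  by rewrite sqrf_eq0 => /eqP ->; rewrite mul0r.
have : u = 0 by rewrite -[u]trmxK (qform1_eq0 u0) trmx0.
by move/eqP; rewrite /u /M mulmxBr mul_mx_scalar subr_eq0 => /eqP <-.
Qed.

(** Induction on the list: appending the columns of [A - a%:M] to [Z] cuts the subspace down to an
    eigenspace of [A], which the remaining matrices preserve because they commute with [A]. *)
Lemma common_eigenvector (As : seq 'M[R]_n) m (Z : 'M[R]_(n, m)) x :
  {in As, forall A, A^T = A} -> {in As &, forall A B, A *m B = B *m A} ->
  {in As, forall A, forall y : 'rV[R]_n, y *m Z = 0 -> y *m A *m Z = 0} ->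
  x != 0 -> x *m Z = 0 ->
  exists v, [/\ v != 0, v *m Z = 0 &
    {in As, forall A, exists a : R, v *m A = a *: v}].
Proof.
elim: As m Z x => [|A As IH] m Z x sA cA iA x0 xZ; first by exists x.
have [v [a [v0 vZ vA]]] :=
  sym_eigenvector (sA A (mem_head _ _)) (iA A (mem_head _ _)) x0 xZ.
have AsP B : B \in As -> B \in A :: As by rewrite inE orbC => ->.
have ZE (y : 'rV[R]_n) : y *m row_mx Z (A - a%:M) = 0 <->
    y *m Z = 0 /\ y *m A = a *: y.
  rewrite mul_mx_row mulmxBr mul_mx_scalar; split=> [|[-> ->]]; last first.
    by rewrite subrr row_mx0.
  by rewrite -row_mx0 => /eq_row_mx[-> /eqP]; rewrite subr_eq0 => /eqP.
have [||||| w [w0 /ZE[wZ wA] wAs]] := IH _ (row_mx Z (A - a%:M)) v.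
- by move=> B /AsP; exact: sA.
- by move=> B C /AsP BA /AsP; exact: cA.
- move=> B BAs y /ZE[yZ yA]; apply/ZE; split; first by apply: iA => //; exact: AsP.
  have BA : B *m A = A *m B by apply: cA; rewrite ?mem_head ?AsP.
  by rewrite -mulmxA BA mulmxA yA scalemxAl.
- by [].
- exact/ZE.
exists w; split=> // B; rewrite inE => /orP[/eqP ->|]; last exact: wAs.
by exists a.
Qed.

Lemma simultaneous_diagonalization (As : seq 'M[R]_n) :
  {in As, forall A, A^T = A} -> {in As &, forall A B, A *m B = B *m A} ->
  exists V : 'M[R]_n, V *m V^T = 1%:M /\
    {in As, forall A, exists d : 'rV[R]_n, V *m A *m V^T = diag_mx d}.
Proof.
move=> sA cA.
suff [V [VV VA]] : exists V : 'M[R]_(n, n), V *m V^T = 1%:M /\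
    {in As, forall A, exists d : 'rV[R]_n, V *m A = diag_mx d *m V}.
  exists V; split=> // A /VA[d dE]; exists d.
  by rewrite dE -mulmxA VV mulmx1.
(* Orthonormal rows are collected one at a time; the form [V *m A = diag_mx d *m V] also makes sense
   for a rectangular [V]. *)
suff H k : (k <= n)%N -> exists V : 'M[R]_(k, n), V *m V^T = 1%:M /\
    {in As, forall A, exists d : 'rV[R]_k, V *m A = diag_mx d *m V}.
  exact: H.
elim: k => [_|k IH kn].
  by exists 0; split=> [|A _]; [|exists 0]; apply/matrixP => -[].
have [V [VV VA]] := IH (ltnW kn).
have kV : kermx V^T != 0.
  rewrite -mxrank_eq0 -lt0n mxrank_ker subn_gt0.
  exact: leq_ltn_trans (rank_leq_col _) kn.
(* The orthogonal complement of the rows found so far is nonzero and, by symmetry of the matrices,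
   invariant. *)
have [|||y [y0 yV yA]] := @common_eigenvector As _ V^T (nz_row (kermx V^T)) sA cA.
- move=> A AAs y yV; have [d dE] := VA A AAs.
  have AV : A *m V^T = V^T *m diag_mx d.
    by rewrite -{1}(sA A AAs) -trmx_mul dE trmx_mul tr_diag_mx.
  by rewrite -mulmxA AV mulmxA yV mul0mx.
- by rewrite nz_row_eq0.
- by apply/sub_kermxP; exact: nz_row_sub.
have q0 : 0 < qform 1%:M y^T by rewrite qform1_gt0 // trmx_eq0.
set q := qform 1%:M y^T in q0.
pose v := (Num.sqrt q)^-1 *: y.
have vV : v *m V^T = 0 by rewrite -scalemxAl yV scaler0.
have vv : v *m v^T = 1%:M.
  apply/matrixP => i j; rewrite !ord1 trmx_scale -scalemxAl -scalemxAr scalerA mxE.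
  have -> : (y *m y^T) 0 0 = q by rewrite /q /qform trmxK mulmx1.
  by rewrite -invfM -expr2 (sqr_sqrtr (ltW q0)) mulVf ?gt_eqF // mxE eqxx.
suff : exists W : 'M[R]_(1 + k, n), W *m W^T = 1%:M /\
    {in As, forall A, exists d : 'rV[R]_(1 + k), W *m A = diag_mx d *m W} by [].
exists (col_mx v V); split.
  rewrite tr_col_mx mul_col_row vv vV VV.
  have -> : V *m v^T = 0 by rewrite -[V]trmxK -trmx_mul vV trmx0.
  by rewrite -scalar_mx_block.
move=> A AAs; have [d dE] := VA A AAs; have [a aE] := yA A AAs.
exists (row_mx a%:M d); rewrite diag_mx_row.
rewrite mul_col_mx dE mul_block_col !mul0mx addr0 add0r.
congr (col_mx _ _); rewrite /v -scalemxAl aE -scalemxAr.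
have -> : diag_mx (a%:M : 'rV[R]_1) = a%:M.
  by apply/matrixP => i j; rewrite !ord1 !mxE !eqxx !mulr1n.
by rewrite mul_scalar_mx.
Qed.
End SimultaneousDiagonalization.

(** * Second-order expansion of the ordered eigenvalues *)

Section EigenvalueExpansion.
Variables (R : realType) (n : nat).
Implicit Types (A B X H W V : 'M[R]_n) (d : 'rV[R]_n).

Lemma finite_near0 (I : finType) (P : I -> R -> Prop) :
  (forall i, exists2 e : R, 0 < e & forall t, 0 < t < e -> P i t) ->
  exists2 e : R, 0 < e & forall t, 0 < t < e -> forall i, P i t.
Proof.
move=> /(_ _)/cid2-/all_sig2[e e0 eP].
exists (\big[Order.min/1]_i e i).
  by elim/big_ind: _ => // x y x0 y0; rewrite lt_min x0.
move=> t /andP[t0 te] i; apply: eP; rewrite t0 /=.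
exact: lt_le_trans te (bigmin_le_cond _ _ _).
Qed.

Lemma sort_perm (r : rel 'I_n) : total r -> transitive r ->
  exists s : 'S_n, forall i j : 'I_n, (i <= j)%N -> r (s i) (s j).
Proof.
move=> rtot rtr; pose t := sort r (ord_tuple n).
have /tuple_permP[s ts] : perm_eq t (ord_tuple n) by rewrite /t perm_sort.
have sz : size t = n by rewrite size_sort size_tuple.
exists s => i j ij.
have nthE (k : 'I_n) : nth i t k = s k.
  by rewrite ts -tnth_nth tnth_mktuple tnth_ord_tuple.
have rr : reflexive r by move=> x; have := rtot x x; rewrite orbb.
have := sorted_leq_nth rtr rr i (sort_sorted rtot (ord_tuple n)).
by move=> /(_ i j); rewrite -/t !nthE; apply; rewrite ?inE ?sz.
Qed.

(** This is the order of the entries of [d0 + t *: d1 + t ^+ 2 *: d2] for all small [t > 0]. *)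
Definition lex_nonincr (d0 d1 d2 : 'rV[R]_n) := forall i j : 'I_n, (i <= j)%N ->
  [|| d0 0 j < d0 0 i | (d0 0 j == d0 0 i) &&
    ((d1 0 j < d1 0 i) || (d1 0 j == d1 0 i) && (d2 0 j <= d2 0 i))].

Lemma lex_sort (d0 d1 d2 : 'rV[R]_n) : exists s : 'S_n,
  lex_nonincr (col_perm s d0) (col_perm s d1) (col_perm s d2).
Proof.
pose r : rel 'I_n := fun i j => [|| d0 0 j < d0 0 i | (d0 0 j == d0 0 i) &&
    ((d1 0 j < d1 0 i) || (d1 0 j == d1 0 i) && (d2 0 j <= d2 0 i))].
have [||s sP] := @sort_perm r.
- move=> i j; rewrite /r; case: (ltgtP (d0 0 j) (d0 0 i)) => //= _.
  by case: (ltgtP (d1 0 j) (d1 0 i)) => //= _; exact: le_total.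
- move=> j i k; rewrite /r.
  case/orP=> [h1|/andP[/eqP h1 /orP[h2|/andP[/eqP h2 h3]]]].
  - case/orP=> [h4|/andP[/eqP h4 _]]; first by rewrite (lt_trans h4 h1).
    by rewrite h4 h1.
  - case/orP=> [h4|/andP[/eqP h4 h5]]; first by rewrite -h1 h4.
    rewrite h4 h1 eqxx ltxx /=; case/orP: h5 => [h5|/andP[/eqP h5 _]].
      by rewrite (lt_trans h5 h2).
    by rewrite h5 h2.
  - case/orP=> [h4|/andP[/eqP h4 h5]]; first by rewrite -h1 h4.
    rewrite h4 h1 eqxx ltxx /=; case/orP: h5 => [h5|/andP[/eqP h5 h6]].
      by rewrite -h2 h5.
    by rewrite h5 h2 eqxx (le_trans h6 h3) orbT.
by exists s => i j ij; have := sP i j ij; rewrite /r !mxE.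
Qed.

Lemma lex_nonincr_quadratic (d0 d1 d2 : 'rV[R]_n) : lex_nonincr d0 d1 d2 ->
  exists2 e : R, 0 < e & forall t, 0 < t < e ->
    nonincr (d0 + t *: d1 + t ^+ 2 *: d2).
Proof.
move=> lexd.
have [|e e0 eP] := @finite_near0 ('I_n * 'I_n)%type (fun ij t => (ij.1 <= ij.2)%N ->
    d0 0 ij.2 + t * d1 0 ij.2 + t ^+ 2 * d2 0 ij.2 <=
    d0 0 ij.1 + t * d1 0 ij.1 + t ^+ 2 * d2 0 ij.1).
  move=> [i j] /=; have [ij|ij] := boolP (i <= j)%N; last by exists 1.
  have := lexd i j ij.
  case/orP=> [h0|/andP[/eqP h0 /orP[h1|/andP[/eqP h1 h2]]]].
  - pose a := d0 0 i - d0 0 j; pose b := d1 0 i - d1 0 j; pose c := d2 0 i - d2 0 j.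
    have a0 : 0 < a by rewrite subr_gt0.
    have D0 : 0 < `|b| + `|c| + 1 by rewrite ltr_wpDl // addr_ge0.
    (* For [t < 1] the two higher terms lose at most [t * (|b| + |c|)], which this bound keeps below
       [a]. *)
    exists (Num.min 1 (a / (`|b| + `|c| + 1))).
      by rewrite lt_min ltr01 divr_gt0.
    move=> t /andP[t0]; rewrite lt_min => /andP[t1].
    rewrite (ltr_pdivlMr _ _ D0) => ta _.
    have := ler_norm (- b); have := ler_norm (- c); rewrite !normrN => hc hb.
    have : t * (- b) <= t * `|b| by rewrite ler_pM2l.
    have : t * (- c) <= t * `|c| by rewrite ler_pM2l.
    have : t ^+ 2 * (- c) <= t ^+ 2 * `|c| by rewrite ler_wpM2l ?sqr_ge0.
    have : t ^+ 2 * `|c| <= t * `|c|.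
      by rewrite ler_wpM2r // expr2 ler_piMr // ltW.
    rewrite /a /b /c in ta *; nra.
  - pose b := d1 0 i - d1 0 j; pose c := d2 0 i - d2 0 j.
    have b0 : 0 < b by rewrite subr_gt0.
    have D0 : 0 < `|c| + 1 by rewrite ltr_wpDl.
    exists (b / (`|c| + 1)); first by rewrite divr_gt0.
    move=> t /andP[t0]; rewrite (ltr_pdivlMr _ _ D0) => tb _.
    have := ler_norm (- c); rewrite normrN => hc.
    have : t * (- c) <= t * `|c| by rewrite ler_pM2l.
    rewrite h0 /b /c in tb * => h.
    have : 0 <= t * (d1 0 i - d1 0 j + t * (d2 0 i - d2 0 j)).
      by apply: mulr_ge0; lra.
    lra.
  - by exists 1 => // t _ _; rewrite h0 h1 lerD2l ler_wpM2l ?sqr_ge0.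
by exists e => // t te i j ij; rewrite !(mxDE, mxZE); exact: (eP t te (i, j) ij).
Qed.

Lemma row_perm_conj V A d (s : 'S_n) : V *m A *m V^T = diag_mx d ->
  row_perm s V *m A *m (row_perm s V)^T = diag_mx (col_perm s d).
Proof.
move=> E; rewrite row_permE trmx_mul tr_perm_mx.
have -> : perm_mx s *m V *m A *m (V^T *m perm_mx s^-1) =
    perm_mx s *m (V *m A *m V^T) *m perm_mx s^-1 by rewrite !mulmxA.
rewrite E -row_permE -col_permE; apply/matrixP => i j; rewrite !mxE.
by rewrite (inj_eq perm_inj).
Qed.

Lemma row_perm_orthogonal V (s : 'S_n) : V *m V^T = 1%:M ->
  row_perm s V *m (row_perm s V)^T = 1%:M.
Proof.
move=> VV; have := @row_perm_conj V 1%:M (const_mx 1) s.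
rewrite !mulmx1 diag_const_mx => /(_ VV) ->.
have -> : col_perm s (const_mx 1 : 'rV[R]_n) = const_mx 1.
  by apply/matrixP => i j; rewrite !mxE.
by rewrite diag_const_mx.
Qed.

Lemma conj_is_eigvals V A d : V *m V^T = 1%:M -> V *m A *m V^T = diag_mx d ->
  nonincr d -> is_eigvals A d.
Proof.
move=> VV E dn; split=> //; exists V^T; rewrite trmxK; split; first exact: mulmx1C.
by rewrite -E !mulmxA (mulmx1C VV) mul1mx -mulmxA (mulmx1C VV) mulmx1.
Qed.

Lemma eigvalsP X : symmx X -> is_eigvals X (eigvals X).
Proof.
move=> sX; rewrite /eigvals; case: pselect => [h|]; first exact: (projT2 (cid h)).
case; have [||V [VV /(_ X)]] := @simultaneous_diagonalization R n [:: X].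
- by move=> A; rewrite inE => /eqP ->.
- by move=> A B; rewrite !inE => /eqP -> /eqP ->.
rewrite inE eqxx => /(_ isT)[d dE].
have [s sP] := lex_sort d 0 0; exists (col_perm s d).
apply: (conj_is_eigvals (row_perm_orthogonal s VV) (row_perm_conj s dE)).
move=> i j /sP /orP[/ltW //|/andP[/eqP -> _]]; exact: lexx.
Qed.

Lemma eigvalsE X d : is_eigvals X d -> eigvals X = d.
Proof.
move=> dP; apply: is_eigvals_uniq (dP); apply: eigvalsP; have [_ [U [_ ->]]] := dP.
by rewrite /symmx !trmx_mul trmxK tr_diag_mx mulmxA.
Qed.

Lemma eigvals_bound X : symmx X -> `|eigvals X| <= n%:R ^+ 2 * `|X|.
Proof.
move=> /eigvalsP[_ [U [UU XE]]]; set l := eigvals X in XE *.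
have lE : diag_mx l = U^T *m X *m U.
  by rewrite XE !mulmxA (mulmx1C UU) mul1mx -mulmxA (mulmx1C UU) mulmx1.
have := @orthogonal_conj_norm R n U^T X; rewrite trmxK -lE => /(_ (mulmx1C UU)) h.
apply: le_trans h; apply: mx_norm_leP => // i j; rewrite ord1.
by have := mx_entry_le (diag_mx l) j j; rewrite mxE eqxx mulr1n.
Qed.

(** An eigenbasis of [Y] diagonalises [X] up to [U^T *m (X - Y) *m U]. Conjugation costs two factors
    [n], the quadratic form a third. *)
Lemma eigvals_lipschitz X Y : symmx X -> symmx Y ->
  `|eigvals X - eigvals Y| <= n%:R ^+ 3 * `|X - Y|.
Proof.
move=> sX sY; have [dn [U [UU YE]]] := eigvalsP sY.
apply: mx_norm_leP => [|i j]; first by rewrite mulr_ge0 ?exprn_ge0.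
rewrite ord1 mxDE mxNE.
have UU' := mulmx1C UU.
have := @eig_quasi_diag R n X U _ _ 0 (n%:R ^+ 2 * `|X - Y|) (eigvalsP sX) dn.
have -> : U^T *m X *m U - diag_mx (eigvals Y) = U^T *m (X - Y) *m U.
  rewrite mulmxBr mulmxBl {2}YE; congr (_ - _).
  by rewrite !mulmxA UU' mul1mx -mulmxA UU' mulmx1.
have := @orthogonal_conj_norm R n U^T (X - Y); rewrite trmxK => /(_ UU') h.
rewrite UU' subrr normr0 => /(_ (lexx _) h j).
by rewrite mul0r addr0 mulrA -exprS.
Qed.

Lemma conj_mul V A B : V *m V^T = 1%:M ->
  (V^T *m A *m V) *m (V^T *m B *m V) = V^T *m (A *m B) *m V.
Proof. by move=> VV; rewrite !mulmxA -[_ *m V *m V^T]mulmxA VV mulmx1. Qed.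

Lemma conj_tr V A : (V^T *m A *m V)^T = V^T *m A^T *m V.
Proof. by rewrite !trmx_mul trmxK mulmxA. Qed.

Lemma conjK V A : V *m V^T = 1%:M -> V^T *m (V *m A *m V^T) *m V = A.
Proof.
move=> /mulmx1C VV; by rewrite !mulmxA VV mul1mx -mulmxA VV mulmx1.
Qed.

(* In a common eigenbasis, [C] collects the entries of [A] lying on the
   eigenspaces of [B], the others being those of a commutator with [B]. *)
Lemma commutant_split X B A : symmx X -> symmx B -> symmx A ->
  X *m B = B *m X -> X *m A = A *m X ->
  exists C K, [/\ symmx C, K^T = - K & A = C + (K *m B - B *m K)] /\
    [/\ X *m C = C *m X, B *m C = C *m B & X *m K = K *m X].
Proof.
move=> sX sB sA XB XA.
have [||V [VV VAs]] := @simultaneous_diagonalization R n [:: X; B].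
- by move=> ?; rewrite !inE => /orP[] /eqP ->.
- by move=> ? ?; rewrite !inE => /orP[] /eqP -> /orP[] /eqP ->.
have [x xE] := VAs X (mem_head _ _).
have [b bE] : exists b : 'rV[R]_n, V *m B *m V^T = diag_mx b.
  by apply: VAs; rewrite !inE eqxx orbT.
have [a aE] : exists a, V *m A *m V^T = a by eexists.
have VV' := mulmx1C VV.
have aT : a^T = a by rewrite -aE !trmx_mul trmxK sA mulmxA.
have aij i j : a j i = a i j by rewrite -[in LHS]aT mxE.
have AE : A = V^T *m a *m V by rewrite -aE conjK.
have XE : X = V^T *m diag_mx x *m V by rewrite -xE conjK.
have BE : B = V^T *m diag_mx b *m V by rewrite -bE conjK.
(* Commutation with [X] means that [a i j] vanishes unless [x 0 i = x 0 j]; [c] and [k] inherit this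
   entry by entry. *)
have xa i j : x 0 i * a i j = a i j * x 0 j.
  have /matrixP/(_ i j) : diag_mx x *m a = a *m diag_mx x.
    rewrite -aE -xE !mulmxA -[_ *m V^T *m V]mulmxA VV' mulmx1.
    by rewrite -[_ *m V^T *m V]mulmxA VV' mulmx1 -!mulmxA [X *m (A *m _)]mulmxA XA !mulmxA.
  by rewrite mul_diag_mx mul_mx_diag !mxE.
pose c : 'M[R]_n := \matrix_(i, j) if b 0 i == b 0 j then a i j else 0.
(* The commutator of [k] with [diag_mx b] has entries [k i j * (b 0 j - b 0 i)], which recovers
   [a i j] off the eigenspaces. *)
pose k : 'M[R]_n := \matrix_(i, j) if b 0 i == b 0 j then 0 else a i j / (b 0 j - b 0 i).
exists (V^T *m c *m V), (V^T *m k *m V); split; split.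
- rewrite /symmx conj_tr; congr (_ *m _ *m _); apply/matrixP => i j.
  by rewrite !mxE eq_sym aij.
- rewrite conj_tr -mulNmx -mulmxN; congr (_ *m _ *m _); apply/matrixP => i j.
  rewrite !mxE eq_sym aij; case: eqP => _; first by rewrite oppr0.
  by rewrite -mulrN -invrN opprB.
- rewrite AE BE !conj_mul // -mulmxBl -mulmxBr -mulmxDl -mulmxDr.
  congr (_ *m _ *m _); apply/matrixP => i j.
  rewrite mxDE mxDE mxNE mul_mx_diag mul_diag_mx !mxE.
  case: eqP => [_|/eqP bij]; first by rewrite mul0r mulr0 subrr addr0.
  have : b 0 j - b 0 i != 0 by rewrite subr_eq0 eq_sym.
  by move=> ?; field.
- rewrite XE !conj_mul //; congr (_ *m _ *m _); apply/matrixP => i j.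
  rewrite mul_mx_diag mul_diag_mx !mxE; case: eqP => _; first exact: xa.
  by rewrite mul0r mulr0.
- rewrite BE !conj_mul //; congr (_ *m _ *m _); apply/matrixP => i j.
  rewrite mul_mx_diag mul_diag_mx !mxE; case: eqP => [->|_]; first exact: mulrC.
  by rewrite mul0r mulr0.
- rewrite XE !conj_mul //; congr (_ *m _ *m _); apply/matrixP => i j.
  rewrite mul_mx_diag mul_diag_mx !mxE; case: eqP => _; first by rewrite mul0r mulr0.
  by rewrite mulrA xa mulrAC.
Qed.

Definition quad A B C (t : R) := A + t *: B + t ^+ 2 *: C.

Definition cubic_close (f g : R -> 'M[R]_n) :=
  exists c : R, forall t, 0 < t <= 1 -> `|f t - g t| <= c * t ^+ 3.

Lemma quad_bound A B C t : 0 < t <= 1 -> `|quad A B C t| <= `|A| + `|B| + `|C|.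
Proof.
move=> /andP[t0 t1]; rewrite /quad.
apply: (le_trans (ler_normD _ _)); apply: lerD.
  apply: (le_trans (ler_normD _ _)); rewrite lerD2l normrZ (ger0_norm (ltW t0)).
  by rewrite ler_piMl.
by rewrite normrZ ger0_norm ?sqr_ge0 // ler_piMl // exprn_ile1 // ltW.
Qed.

(** Second-order Taylor polynomials multiply; what their product leaves beyond the square is
    [t ^+ 3] times a matrix bounded on [0 < t <= 1]. *)
Lemma cubic_close_mul (f g : R -> 'M[R]_n) A0 A1 A2 B0 B1 B2 :
  cubic_close f (quad A0 A1 A2) -> cubic_close g (quad B0 B1 B2) ->
  cubic_close (fun t => f t *m g t)
    (quad (A0 *m B0) (A0 *m B1 + A1 *m B0) (A0 *m B2 + A1 *m B1 + A2 *m B0)).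
Proof.
move=> [c fc] [c' gc].
set cA := `|A0| + `|A1| + `|A2|; set cB := `|B0| + `|B1| + `|B2|.
exists (n%:R * c * (cB + c') + n%:R * cA * c' +
  (`|A1 *m B2| + `|A2 *m B1| + `|A2 *m B2|)).
move=> t t01; have /andP[t0 t1] := t01.
have t3 : 0 < t ^+ 3 by rewrite exprn_gt0.
have t31 : t ^+ 3 <= 1 by rewrite exprn_ile1 // ltW.
have ft := fc t t01; have gt := gc t t01.
have c0 : 0 <= c by rewrite -(pmulr_lge0 _ t3); apply: le_trans ft.
have c'0 : 0 <= c' by rewrite -(pmulr_lge0 _ t3); apply: le_trans gt.
set p := quad A0 A1 A2 t in ft *; set q := quad B0 B1 B2 t in gt *.
have pA : `|p| <= cA by exact: quad_bound.
have qB : `|q| <= cB by exact: quad_bound.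
have gB : `|g t| <= cB + c'.
  rewrite -[g t](subrK q) addrC (le_trans (ler_normD _ _)) // lerD //.
  by rewrite (le_trans gt) // ler_piMr.
have E : f t *m g t - quad (A0 *m B0) (A0 *m B1 + A1 *m B0)
      (A0 *m B2 + A1 *m B1 + A2 *m B0) t =
    (f t - p) *m g t + p *m (g t - q) +
    t ^+ 3 *: (A1 *m B2 + A2 *m B1 + t *: (A2 *m B2)).
  have -> : (f t - p) *m g t + p *m (g t - q) = f t *m g t - p *m q.
    by rewrite mulmxBl mulmxBr; apply/matrixP => i j; rewrite !(mxDE, mxNE); ring.
  rewrite /p /q /quad.
  rewrite !(mulmxDl, mulmxDr) -!(scalemxAl, scalemxAr) !scalerA.
  apply/matrixP => i j; rewrite !(mxDE, mxNE, mxZE); ring.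
rewrite E (le_trans (ler_normD _ _)) // mulrDl lerD //.
  rewrite (le_trans (ler_normD _ _)) // mulrDl lerD //.
    rewrite (le_trans (mx_norm_mul _ _)) //.
    have -> : n%:R * c * (cB + c') * t ^+ 3 = n%:R * (c * t ^+ 3) * (cB + c') by ring.
    by rewrite ler_pM ?mulr_ge0 // ler_wpM2l.
  rewrite (le_trans (mx_norm_mul _ _)) //.
  by rewrite -[X in _ <= X]mulrA ler_pM ?mulr_ge0 // ler_wpM2l.
rewrite normrZ (ger0_norm (ltW t3)) mulrC; apply: ler_wpM2r; first exact: ltW.
rewrite (le_trans (ler_normD _ _)) // lerD ?ler_normD // normrZ (ger0_norm (ltW t0)).
by rewrite ler_piMl.
Qed.

Lemma cubic_close_refl f : cubic_close f f.
Proof. by exists 0 => t _; rewrite subrr normr0 mul0r. Qed.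

(** By skewness the transpose of [P] has coefficients [- A] and [A^2 / 2 - L], so the coefficients
    of [t] and [t^2] in [P^T *m P] cancel. The two equations name the corresponding coefficients of
    the conjugated matrix. *)
Lemma near_orthogonal_diag X H W A L B C : A^T = - A -> L^T = - L ->
  let A2 := 2^-1 *: (A *m A) + L in
  H + X *m A - A *m X = B ->
  2^-1 *: W + (X *m A2 + H *m A) - A *m (X *m A + H) +
    (2^-1 *: (A *m A) - L) *m X = C ->
  exists (c : R), forall t, 0 < t <= 1 ->
    let P := quad 1%:M A A2 t in
    `|P^T *m P - 1%:M| <= c * t ^+ 3 /\
    `|P^T *m (X + t *: H + (t ^+ 2 / 2) *: W) *m P - quad X B C t| <= c * t ^+ 3.
Proof.
move=> AT LT A2 eB eC.
pose A2' := 2^-1 *: (A *m A) - L.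
have PT t : (quad 1%:M A A2 t)^T = quad 1%:M (- A) A2' t.
  rewrite /quad /A2 !trmx_add !trmx_scale trmx1 AT trmx_add trmx_scale trmx_mul AT LT.
  by rewrite mulNmx mulmxN opprK.
have YE t : X + t *: H + (t ^+ 2 / 2) *: W = quad X H (2^-1 *: W) t.
  by rewrite /quad scalerA.
pose fP t := quad 1%:M A A2 t; pose fY t := quad X H (2^-1 *: W) t.
pose fPT t := quad 1%:M (- A) A2' t.
have [c1 H1] := cubic_close_mul (cubic_close_refl fPT) (cubic_close_refl fP).
have [c2 H2] := cubic_close_mul
  (cubic_close_mul (cubic_close_refl fPT) (cubic_close_refl fY)) (cubic_close_refl fP).
exists (Num.max c1 c2) => t t01 /=.
have t3 : 0 <= t ^+ 3 by rewrite exprn_ge0 // ltW //; case/andP: t01.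
have HH := (H1 t t01, H2 t t01); rewrite PT YE; split.
  apply: (@le_trans _ _ (c1 * t ^+ 3)); last by rewrite ler_wpM2r // le_max lexx.
  have E : quad (1%:M *m 1%:M) (1%:M *m A + - A *m 1%:M)
     (1%:M *m A2 + - A *m A + A2' *m 1%:M) t = 1%:M.
    rewrite /quad !(mul1mx, mulmx1) subrr scaler0 addr0 /A2 /A2' mulNmx.
    by apply/matrixP => i j; rewrite !(mxDE, mxNE, mxZE); field.
  by move: HH.1; rewrite E.
apply: (@le_trans _ _ (c2 * t ^+ 3)); last by rewrite ler_wpM2r // le_max lexx orbT.
suff <- : quad (1%:M *m X *m 1%:M) (1%:M *m X *m A + (1%:M *m H + - A *m X) *m 1%:M)
    (1%:M *m X *m A2 + (1%:M *m H + - A *m X) *m A +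
     (1%:M *m (2^-1 *: W) + - A *m H + A2' *m X) *m 1%:M) t = quad X B C t.
  exact: HH.2.
rewrite !(mul1mx, mulmx1); congr (_ + _ *: _ + _ *: _).
  by rewrite -eB mulNmx; apply/matrixP => i j; rewrite !(mxDE, mxNE, mxZE); ring.
rewrite -eC /A2 /A2' !(mulmxDl, mulmxDr, mulNmx, mulmxN) -!(scalemxAl, scalemxAr) !mulmxA.
by apply/matrixP => i j; rewrite !(mxDE, mxNE, mxZE); ring.
Qed.

Lemma symmx_add A B : symmx A -> symmx B -> symmx (A + B).
Proof. by rewrite /symmx trmx_add => -> ->. Qed.

Lemma symmx_scale (a : R) A : symmx A -> symmx (a *: A).
Proof. by rewrite /symmx trmx_scale => ->. Qed.

(** [Q = P V^T] diagonalises the three coefficients at once up to [O(t^3)], and the lexicographic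
    order makes the diagonal nonincreasing for small [t], as the eigenvalue comparison requires. *)
Lemma eigvals_quad X H W A L B C V (d0 d1 d2 : 'rV[R]_n) :
  symmx X -> symmx H -> symmx W -> A^T = - A -> L^T = - L ->
  H + X *m A - A *m X = B ->
  2^-1 *: W + (X *m (2^-1 *: (A *m A) + L) + H *m A) - A *m (X *m A + H) +
    (2^-1 *: (A *m A) - L) *m X = C ->
  V *m V^T = 1%:M ->
  V *m X *m V^T = diag_mx d0 -> V *m B *m V^T = diag_mx d1 ->
  V *m C *m V^T = diag_mx d2 -> lex_nonincr d0 d1 d2 ->
  exists c : R, exists2 e : R, 0 < e & forall t, 0 < t < e ->
    `|eigvals (X + t *: H + (t ^+ 2 / 2) *: W) - (d0 + t *: d1 + t ^+ 2 *: d2)|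
      <= c * t ^+ 3.
Proof.
move=> sX sH sW AT LT eB eC VV dX dB dC lexd.
have [c cP] := near_orthogonal_diag AT LT eB eC.
have [e e0 eP] := lex_nonincr_quadratic lexd.
(* A bound for the eigenvalues valid for [0 < t <= 1]: the comparison multiplies the defect of
   orthogonality by their size. *)
set M := n%:R ^+ 2 * (`|X| + `|H| + `|2^-1 *: W|).
exists (n%:R * (n%:R ^+ 2 * c) * (1 + M)), (Num.min e 1); first by rewrite lt_min e0 ltr01.
move=> t /andP[t0]; rewrite lt_min => /andP[te t1].
have t01 : 0 < t <= 1 by rewrite t0 ltW.
have {cP} /= := cP t t01; set A2 := 2^-1 *: (A *m A) + L; set P := quad 1%:M A A2 t.
set Y := X + t *: H + (t ^+ 2 / 2) *: W => -[c1 c2].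
have sY : symmx Y by do 2 (apply: symmx_add => //; last exact: symmx_scale).
have ct0 : 0 <= c * t ^+ 3 by apply: le_trans c1.
have VV' := mulmx1C VV.
pose Q := P *m V^T.
have q1 : `|Q^T *m Q - 1%:M| <= n%:R ^+ 2 * (c * t ^+ 3).
  have -> : Q^T *m Q - 1%:M = V *m (P^T *m P - 1%:M) *m V^T.
    by rewrite /Q trmx_mul trmxK mulmxBr mulmxBl mulmx1 VV !mulmxA.
  by apply: le_trans (orthogonal_conj_norm _ VV) _; rewrite ler_wpM2l // exprn_ge0.
have q2 : `|Q^T *m Y *m Q - diag_mx (d0 + t *: d1 + t ^+ 2 *: d2)| <=
    n%:R ^+ 2 * (c * t ^+ 3).
  have -> : Q^T *m Y *m Q - diag_mx (d0 + t *: d1 + t ^+ 2 *: d2) =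
      V *m (P^T *m Y *m P - quad X B C t) *m V^T.
    rewrite /Q trmx_mul trmxK mulmxBr mulmxBl !mulmxA; congr (_ - _).
    rewrite /quad !(mulmxDr, mulmxDl) -!(scalemxAr, scalemxAl) dX dB dC.
    by apply/matrixP => i j; rewrite !mxE !mulrnAr -!mulrnDl.
  by apply: le_trans (orthogonal_conj_norm _ VV) _; rewrite ler_wpM2l // exprn_ge0.
have tt : 0 < t < e by rewrite t0.
have B1 := eig_quasi_diag (eigvalsP sY) (eP t tt) q1 q2.
have lM : `|eigvals Y| <= M.
  apply: le_trans (eigvals_bound sY) _; rewrite ler_wpM2l ?exprn_ge0 //.
  have -> : Y = quad X H (2^-1 *: W) t by rewrite /quad scalerA.
  exact: quad_bound.
set e1 := n%:R ^+ 2 * (c * t ^+ 3) in q1 q2 B1.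
have e10 : 0 <= e1 by rewrite mulr_ge0 // exprn_ge0.
have E : n%:R * (n%:R ^+ 2 * c) * (1 + M) * t ^+ 3 = n%:R * (e1 + e1 * M).
  by rewrite /e1; ring.
have M0 : 0 <= M by exact: le_trans lM.
rewrite E; apply: mx_norm_leP => [|i j].
  by rewrite mulr_ge0 // addr_ge0 // mulr_ge0.
rewrite ord1 mxDE mxNE (le_trans (B1 j)) //; apply: ler_wpM2l => //.
by rewrite lerD2l ler_wpM2l // (le_trans _ lM) // mx_entry_le.
Qed.

(* The coefficients of [P^T *m Y *m P] for [P] of the form
   [1 + t A + t^2 (A^2 / 2 + L)], which is orthogonal up to third order. *)
Lemma conj_coefficients X B C K M L W : X *m M = M *m X ->
  let N := K *m X - X *m K in
  2^-1 *: W = C + (M *m B - B *m M) + (L *m X - X *m L) - (B *m K - K *m B)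
    - 2^-1 *: (N *m K - K *m N) ->
  let A := K + M in
  let A' := L + 2^-1 *: (K *m M - M *m K) in
  (B + N) + X *m A - A *m X = B /\
  2^-1 *: W + (X *m (2^-1 *: (A *m A) + A') + (B + N) *m A)
    - A *m (X *m A + (B + N)) + (2^-1 *: (A *m A) - A') *m X = C.
Proof.
move=> XM N WE A A'; rewrite {}WE.
have XM' Z : Z *m X *m M = Z *m M *m X by rewrite -!mulmxA XM.
(* Here [2^-1 *: (A *m A) + A'] equals [K^2/2 + K M + M^2/2 + L], the [t^2] coefficient of
   [exp(t K) exp(t M) exp(t^2 L)]. *)
rewrite /A /A' /N; split.
  rewrite !(mulmxDl, mulmxDr) XM.
  by apply/matrixP => i j; rewrite !(mxDE, mxNE, mxZE); ring.
rewrite !(mulmxDl, mulmxDr, mulNmx, mulmxN) -!(scalemxAl, scalemxAr).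
rewrite !(mulmxDl, mulmxDr, mulNmx, mulmxN) !mulmxA !(XM', XM).
by apply/matrixP => i j; rewrite !(mxDE, mxNE, mxZE); field.
Qed.

Lemma symmx_sub A B : symmx A -> symmx B -> symmx (A - B).
Proof. by rewrite /symmx trmx_add trmx_opp => -> ->. Qed.

Lemma symmx0 : symmx (0 : 'M[R]_n).
Proof. exact: trmx0. Qed.

Lemma symmx_conj_diag V (d : 'rV[R]_n) : symmx (V^T *m diag_mx d *m V).
Proof. by rewrite /symmx conj_tr tr_diag_mx. Qed.

Lemma symmx_commutator B K : symmx B -> K^T = - K -> symmx (K *m B - B *m K).
Proof.
move=> sB KT; rewrite /symmx trmx_add trmx_opp !trmx_mul KT sB.
by rewrite mulNmx mulmxN opprK addrC.
Qed.

Lemma skew_commutator A K : A^T = - A -> K^T = - K ->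
  (K *m A - A *m K)^T = - (K *m A - A *m K).
Proof.
move=> AT KT; rewrite trmx_add trmx_opp !trmx_mul KT AT.
by rewrite !mulNmx !mulmxN !opprK opprB.
Qed.

Definition parabolic_expansion X H W (l1 l2 : 'rV[R]_n) :=
  exists c : R, exists2 e : R, 0 < e & forall t, 0 < t < e ->
    `|eigvals (X + t *: H + (t ^+ 2 / 2) *: W) -
      (eigvals X + t *: l1 + (t ^+ 2 / 2) *: l2)| <= c * t ^+ 3.

(** Serves both to expand along a given [W] and, read backwards from chosen [B] and [C], to build
    directions with prescribed derivatives. *)
Lemma eigvals_conj X B C K M L W V (d0 d1 d2 : 'rV[R]_n) :
  symmx X -> symmx B -> symmx W -> K^T = - K -> M^T = - M -> L^T = - L ->
  X *m M = M *m X ->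
  let N := K *m X - X *m K in
  2^-1 *: W = C + (M *m B - B *m M) + (L *m X - X *m L) - (B *m K - K *m B)
    - 2^-1 *: (N *m K - K *m N) ->
  V *m V^T = 1%:M ->
  V *m X *m V^T = diag_mx d0 -> V *m B *m V^T = diag_mx d1 ->
  V *m C *m V^T = diag_mx (2^-1 *: d2) -> lex_nonincr d0 d1 (2^-1 *: d2) ->
  eigvals X = d0 /\ parabolic_expansion X (B + N) W d1 d2.
Proof.
move=> sX sB sW KT MT LT XM N WE VV dX dB dC lexd.
have XE : eigvals X = d0.
  apply/eigvalsE/(conj_is_eigvals VV dX) => i j ij.
  by have /orP[/ltW //|/andP[/eqP -> _]] := lexd i j ij.
split=> //; have [eB eC] := conj_coefficients XM WE.
have sN : symmx (B + N) by apply: symmx_add => //; exact: symmx_commutator.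
have AT : (K + M)^T = - (K + M) by rewrite trmx_add KT MT opprD.
have A'T : (L + 2^-1 *: (K *m M - M *m K))^T = - (L + 2^-1 *: (K *m M - M *m K)).
  by rewrite trmx_add trmx_scale LT skew_commutator // scalerN opprD.
have [c [e e0 H]] := eigvals_quad sX sN sW AT A'T eB eC VV dX dB dC lexd.
exists c, e => // t te; have := H t te.
by rewrite XE scalerA.
Qed.

Lemma tangent_split X H : symmx X -> symmx H -> exists B K,
  [/\ symmx B, K^T = - K, H = B + (K *m X - X *m K) & X *m B = B *m X].
Proof.
move=> sX sH.
(* Taking [0] as the first matrix makes commutation with it trivial. *)
have [||B [K [[sB KT HE] [_ XB _]]]] := commutant_split symmx0 sX sH.
- by rewrite mul0mx mulmx0.
- by rewrite mul0mx mulmx0.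
by exists B, K.
Qed.

Lemma parabolic_expansion_exists X H W : symmx X -> symmx H -> symmx W ->
  exists l1 l2 : 'rV[R]_n, parabolic_expansion X H W l1 l2.
Proof.
move=> sX sH sW; have [B [K [sB KT HE XB]]] := tangent_split sX sH.
set N := K *m X - X *m K in HE.
have sN : symmx N by exact: symmx_commutator.
(* What remains of [W / 2] after the second-order effect of [K]. It is split relatively to [X],
   giving [L], and its part commuting with [X] is split relatively to [B], giving [M] and [C]. *)
pose Z := 2^-1 *: W - (K *m B - B *m K) - 2^-1 *: (K *m N - N *m K).
have sZ : symmx Z.
  apply: symmx_sub; last by apply: symmx_scale; exact: symmx_commutator.
  by apply: symmx_sub; [exact: symmx_scale | exact: symmx_commutator].
have [G [L [sG LT ZE XG]]] := tangent_split sX sZ.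
have [C [M [[sC MT GE] [XC BC XM]]]] := commutant_split sX sB sG XB XG.
have [||V [VV VAs]] := @simultaneous_diagonalization R n [:: X; B; C].
- by move=> ?; rewrite !inE => /or3P[] /eqP ->.
- by move=> ? ?; rewrite !inE => /or3P[] /eqP -> /or3P[] /eqP ->.
have [d0 dX] : exists d : 'rV[R]_n, V *m X *m V^T = diag_mx d.
  by apply: VAs; rewrite !inE eqxx.
have [d1 dB] : exists d : 'rV[R]_n, V *m B *m V^T = diag_mx d.
  by apply: VAs; rewrite !inE eqxx orbT.
have [d2 dC] : exists d : 'rV[R]_n, V *m C *m V^T = diag_mx d.
  by apply: VAs; rewrite !inE eqxx !orbT.
have [s lexd] := lex_sort d0 d1 d2.
(* The expansion carries [t^2 / 2], so the second derivative is twice the diagonal of [C]. *)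
have d2E : col_perm s d2 = 2^-1 *: (2 *: col_perm s d2).
  by rewrite scalerA mulVf ?scale1r // pnatr_eq0.
exists (col_perm s d1), (2 *: col_perm s d2).
have WE : 2^-1 *: W = C + (M *m B - B *m M) + (L *m X - X *m L)
    - (B *m K - K *m B) - 2^-1 *: (N *m K - K *m N).
  rewrite -GE -ZE /Z; apply/matrixP => i j; rewrite !(mxDE, mxNE, mxZE); ring.
have [||_] := @eigvals_conj _ _ _ _ _ _ _ _ _ _ (2 *: col_perm s d2)
  sX sB sW KT MT LT XM WE
  (row_perm_orthogonal s VV) (row_perm_conj s dX) (row_perm_conj s dB).
- by rewrite -d2E; exact: row_perm_conj.
- by rewrite -d2E.
by rewrite HE.
Qed.

Lemma cvg_at_right0 (f : R -> 'rV[R]_n) l (c e : R) : 0 < e ->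
  (forall t, 0 < t < e -> `|f t - l| <= c * t) -> f @ 0^'+ --> l.
Proof.
move=> e0 fl; apply/cvgrPdist_le => eps eps0.
have c1 : 0 < `|c| + 1 by rewrite ltr_wpDl.
near=> t.
have t0 : 0 < t by near: t; exact: nbhs_right_gt.
have te : t < e by near: t; exact: nbhs_right_lt.
have tc : t < eps / (`|c| + 1).
  by near: t; apply: nbhs_right_lt; rewrite divr_gt0.
rewrite distrC (le_trans (fl t _)) ?t0 //.
rewrite ltr_pdivlMr // in tc; apply: le_trans (ltW tc).
rewrite mulrC ler_pM2l // (le_trans (ler_norm _)) // lerDl //.
Unshelve. all: by end_near.
Qed.

Lemma lim_at_right0 (f : R -> 'rV[R]_n) l (c e : R) : 0 < e ->
  (forall t, 0 < t < e -> `|f t - l| <= c * t) -> lim (f @ 0^'+) = l.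
Proof.
by move=> e0 /(cvg_at_right0 e0); apply: cvg_lim; exact: norm_hausdorff.
Qed.

(** The eigenvalues are Lipschitz, so the term [(t ^+ 2 / 2) *: W] moves them by [O(t^2)] only and
    dropping it does not affect the first-order limit. *)
Lemma parabolic_expansion_d1 X H W (l1 l2 : 'rV[R]_n) :
  symmx X -> symmx H -> symmx W ->
  parabolic_expansion X H W l1 l2 -> eig_d1 X H = l1.
Proof.
move=> sX sH sW [c [e e0 E]].
apply: (@lim_at_right0 _ _ (n%:R ^+ 3 * `|W| + `|c| + `|l2|) (Num.min e 1)).
  by rewrite lt_min e0 ltr01.
move=> t /andP[t0]; rewrite lt_min => /andP[te t1].
have {E} := E t; rewrite t0 te => /(_ isT).
set Y := X + t *: H + _; set Y1 := X + t *: H => EY.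
have sY1 : symmx Y1 by apply: symmx_add => //; exact: symmx_scale.
have sY : symmx Y by apply: symmx_add => //; exact: symmx_scale.
have lip := eigvals_lipschitz sY1 sY.
have t2 : 0 < t ^+ 2 / 2 by rewrite divr_gt0 // exprn_gt0.
have YY : `|Y1 - Y| = t ^+ 2 / 2 * `|W|.
  by rewrite /Y opprD addNKr normrN normrZ gtr0_norm // /Y1 addrA.
have -> : t^-1 *: (eigvals Y1 - eigvals X) - l1 =
    t^-1 *: ((eigvals Y1 - eigvals Y) +
      (eigvals Y - (eigvals X + t *: l1 + (t ^+ 2 / 2) *: l2)) + (t ^+ 2 / 2) *: l2).
  have {1}-> : l1 = t^-1 *: (t *: l1) by rewrite scalerA mulVf ?scale1r ?gt_eqF.
  rewrite -scalerBr; congr (_ *: _); apply/matrixP => i j.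
  by rewrite !(mxDE, mxNE, mxZE); ring.
rewrite normrZ gtr0_norm ?invr_gt0 // mulrC ler_pdivrMr //.
rewrite (le_trans (ler_normD _ _)) // normrZ (gtr0_norm t2).
have := ler_normD (eigvals Y1 - eigvals Y)
  (eigvals Y - (eigvals X + t *: l1 + (t ^+ 2 / 2) *: l2)).
move: lip EY; rewrite YY.
set a := `|eigvals Y1 - eigvals Y|; set b := `|eigvals Y - _|; set q := `|_ + _|.
have : c * t ^+ 3 <= `|c| * t ^+ 2.
  have h1 : c * t ^+ 3 <= `|c| * t ^+ 3.
    by rewrite ler_wpM2r ?ler_norm // exprn_ge0 // ltW.
  apply: le_trans h1 _; rewrite ler_wpM2l // exprS ler_piMl ?sqr_ge0 // ltW //.
have : 0 <= n%:R ^+ 3 * `|W| * t ^+ 2 by rewrite mulr_ge0 ?sqr_ge0 // mulr_ge0 // exprn_ge0.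
have : 0 <= `|l2| * t ^+ 2 by rewrite mulr_ge0 ?sqr_ge0.
rewrite -[_ * t * t]mulrA -expr2 !mulrDl.
lra.
Qed.

Lemma parabolic_expansion_d2 X H W (l1 l2 : 'rV[R]_n) :
  symmx X -> symmx H -> symmx W ->
  parabolic_expansion X H W l1 l2 -> eig_d2 X H W = l2.
Proof.
move=> sX sH sW E12; have l1E := parabolic_expansion_d1 sX sH sW E12.
have [c [e e0 E]] := E12.
apply: (@lim_at_right0 _ _ (2 * c) e) => // t te; have /andP[t0 _] := te.
have t2 : 0 < t ^+ 2 / 2 by rewrite divr_gt0 // exprn_gt0.
have := E t te; rewrite l1E.
set Y := X + t *: H + _.
have -> : (t ^+ 2 / 2)^-1 *: (eigvals Y - eigvals X - t *: l1) - l2 =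
    (t ^+ 2 / 2)^-1 *: (eigvals Y - (eigvals X + t *: l1 + (t ^+ 2 / 2) *: l2)).
  have {1}-> : l2 = (t ^+ 2 / 2)^-1 *: ((t ^+ 2 / 2) *: l2).
    by rewrite scalerA mulVf ?scale1r ?gt_eqF.
  by rewrite -scalerBr !opprD !addrA.
move=> h; rewrite normrZ gtr0_norm ?invr_gt0 // mulrC ler_pdivrMr //.
by have -> : 2 * c * t * (t ^+ 2 / 2) = c * t ^+ 3 by field.
Qed.

Lemma eigvals_expansion X H W : symmx X -> symmx H -> symmx W ->
  parabolic_expansion X H W (eig_d1 X H) (eig_d2 X H W).
Proof.
move=> sX sH sW; have [l1 [l2 E]] := parabolic_expansion_exists sX sH sW.
by rewrite (parabolic_expansion_d1 sX sH sW E) (parabolic_expansion_d2 sX sH sW E).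
Qed.

(** Second derivatives come out sorted on the common ties of [eigvals X] and [eig_d1 X H], so [z] is
    reached only up to a permutation fixing both; a symmetric [theta] does not see it. *)
Lemma eig_d2_surj X H (z : 'rV[R]_n) : symmx X -> symmx H ->
  exists W (s : 'S_n), [/\ symmx W, col_perm s (eigvals X) = eigvals X,
    col_perm s (eig_d1 X H) = eig_d1 X H & eig_d2 X H W = col_perm s z].
Proof.
move=> sX sH; have [B [K [sB KT HE XB]]] := tangent_split sX sH.
set N := K *m X - X *m K in HE.
have sN : symmx N by exact: symmx_commutator.
(* Solves the second-order equation for [W] with [C] prescribed and [L = M = 0]. *)
pose W_ C := 2 *: (C + (K *m B - B *m K) + 2^-1 *: (K *m N - N *m K)).
have sW C : symmx C -> symmx (W_ C).
  move=> sC; apply: symmx_scale; apply: symmx_add.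
    by apply: symmx_add => //; exact: symmx_commutator.
  by apply: symmx_scale; exact: symmx_commutator.
have z0 : (0 : 'M[R]_n)^T = - 0 by rewrite trmx0 oppr0.
have X0 : X *m 0 = 0 *m X by rewrite mul0mx mulmx0.
have WE C : 2^-1 *: W_ C = C + (0 *m B - B *m 0) + (0 *m X - X *m 0)
    - (B *m K - K *m B) - 2^-1 *: (N *m K - K *m N).
  rewrite !(mul0mx, mulmx0) /W_.
  by apply/matrixP => i j; rewrite !(mxDE, mxNE, mxZE); field.
have expand C V (d0 d1 d2 : 'rV[R]_n) : symmx C -> V *m V^T = 1%:M ->
    V *m X *m V^T = diag_mx d0 -> V *m B *m V^T = diag_mx d1 ->
    V *m C *m V^T = diag_mx (2^-1 *: d2) -> lex_nonincr d0 d1 (2^-1 *: d2) ->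
    [/\ eigvals X = d0, eig_d1 X H = d1 & eig_d2 X H (W_ C) = d2].
  move=> sC VV dX dB dC lexd.
  have [XE E] := eigvals_conj sX sB (sW C sC) KT z0 z0 X0 (WE C) VV dX dB dC lexd.
  rewrite -HE in E; split=> //.
    exact: parabolic_expansion_d1 (sW C sC) E.
  exact: parabolic_expansion_d2 (sW C sC) E.
have [||V [VV VAs]] := @simultaneous_diagonalization R n [:: X; B].
- by move=> ?; rewrite !inE => /orP[] /eqP ->.
- by move=> ? ?; rewrite !inE => /orP[] /eqP -> /orP[] /eqP ->.
have [d0 dX] := VAs X (mem_head _ _).
have [d1 dB] : exists b : 'rV[R]_n, V *m B *m V^T = diag_mx b.
  by apply: VAs; rewrite !inE eqxx orbT.
(* A first pass with [C = 0] arranges the eigenbasis so that the diagonals are exactly [eigvals X]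
   and [eig_d1 X H]. *)
have [s1 lex1] := lex_sort d0 d1 (2^-1 *: 0).
have [||XE HE1 _] := expand 0 _ _ _ 0 symmx0 (row_perm_orthogonal s1 VV)
  (row_perm_conj s1 dX) (row_perm_conj s1 dB).
- by rewrite mulmx0 mul0mx scaler0 linear0.
- move: lex1; rewrite !scaler0.
  by have -> : col_perm s1 0 = 0 :> 'rV[R]_n by apply/matrixP => i j; rewrite !mxE.
move: XE HE1 (row_perm_conj s1 dX) (row_perm_conj s1 dB) (row_perm_orthogonal s1 VV).
move: (row_perm s1 V) => V1 <- <- dX1 dB1 VV1 {V VV VAs dX dB lex1 d0 d1}.
(* Sorting again with [z] as last key permutes only ties of these two vectors. *)
have [s lexs] := lex_sort (eigvals X) (eig_d1 X H) (2^-1 *: z).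
have zE : col_perm s (2^-1 *: z) = 2^-1 *: col_perm s z.
  by apply/matrixP => i j; rewrite !mxE.
rewrite zE in lexs.
pose V2 := row_perm s V1; have VV2 := row_perm_orthogonal s VV1; rewrite -/V2 in VV2.
pose C := V2^T *m diag_mx (2^-1 *: col_perm s z) *m V2.
have dC : V2 *m C *m V2^T = diag_mx (2^-1 *: col_perm s z).
  by rewrite /C !mulmxA VV2 mul1mx -mulmxA VV2 mulmx1.
have [E0 E1 E2] := expand C V2 _ _ _ (symmx_conj_diag _ _) VV2 (row_perm_conj s dX1)
  (row_perm_conj s dB1) dC lexs.
by exists (W_ C), s; split=> //; exact/sW/symmx_conj_diag.
Qed.

(** [H] is built in an eigenbasis of [X], hence commutes with it and calls for no skew correction;
    ordering [w] inside the eigenspaces costs the permutation. *)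
Lemma eig_d1_surj X (w : 'rV[R]_n) : symmx X ->
  exists H (s : 'S_n), [/\ symmx H, col_perm s (eigvals X) = eigvals X &
    eig_d1 X H = col_perm s w].
Proof.
move=> sX; have [ln [U [UU XE]]] := eigvalsP sX.
have UU' := mulmx1C UU.
have dX : U^T *m X *m U^T^T = diag_mx (eigvals X).
  by rewrite trmxK {1}XE !mulmxA UU' mul1mx -mulmxA UU' mulmx1.
have VV : U^T *m U^T^T = 1%:M by rewrite trmxK.
have [s lexs] := lex_sort (eigvals X) w 0.
pose V := row_perm s U^T; have VV1 := row_perm_orthogonal s VV; rewrite -/V in VV1.
pose H := V^T *m diag_mx (col_perm s w) *m V.
have sH : symmx H by exact: symmx_conj_diag.
have dH : V *m H *m V^T = diag_mx (col_perm s w).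
  by rewrite /H !mulmxA VV1 mul1mx -mulmxA VV1 mulmx1.
have z0 : (0 : 'M[R]_n)^T = - 0 by rewrite trmx0 oppr0.
have X0 : X *m 0 = 0 *m X by rewrite mul0mx mulmx0.
have E0 : 2^-1 *: 0 = 0 + (0 *m H - H *m 0) + (0 *m X - X *m 0) - (H *m 0 - 0 *m H) -
    2^-1 *: ((0 *m X - X *m 0) *m 0 - 0 *m (0 *m X - X *m 0)).
  by rewrite !(mul0mx, mulmx0, subrr, scaler0, addr0, subr0).
have [||XE1 E] := eigvals_conj sX sH symmx0 z0 z0 z0 X0 E0 VV1 (row_perm_conj s dX) dH
  (d2 := 0).
- by rewrite mulmx0 mul0mx scaler0 linear0.
- move: lexs; rewrite scaler0.
  by have -> : col_perm s 0 = 0 :> 'rV[R]_n by apply/matrixP => i j; rewrite !mxE.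
rewrite mul0mx mulmx0 subrr addr0 in E.
by exists H, s; split=> //; exact: parabolic_expansion_d1 sX sH symmx0 E.
Qed.

End EigenvalueExpansion.

(** * Majorization, Ky Fan's inequality and Davis' convexity theorem *)

Section SpectralConvexity.
Variables (R : realType) (n : nat).
Implicit Types (A B V : 'M[R]_n) (x y : 'rV[R]_n) (theta : 'rV[R]_n -> \bar R).

Definition prefix_sum (d : 'I_n -> R) (m : nat) := \sum_(i < n | (i < m)%N) d i.

Lemma prefix_sum_all (d : 'I_n -> R) : prefix_sum d n = \sum_i d i.
Proof. by apply: eq_bigl => i; rewrite ltn_ord. Qed.

Lemma prefix_sumS (d : 'I_n -> R) (j : 'I_n) : prefix_sum d j.+1 = d j + prefix_sum d j.
Proof.
rewrite /prefix_sum (bigD1 j) //=; congr (_ + _); apply: eq_bigl => i.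
by rewrite ltnS andbC ltn_neqAle.
Qed.

Lemma sym_fun_col_perm theta (s : 'S_n) x : sym_fun theta -> theta (col_perm s x) = theta x.
Proof. by move=> symt; rewrite col_permE symt. Qed.

(* One averaging step (a T-transform): moving a mass [t] from coordinate [j] to
   coordinate [k] is a convex combination of [x] and of [x] with [j], [k]
   exchanged. *)
Lemma transfer_le theta x (j k : 'I_n) (t al : R) :
  sym_fun theta -> convex_on [set: 'rV[R]_n] theta ->
  x 0 k < x 0 j -> 0 < t < x 0 j - x 0 k -> (theta x <= al%:E)%E ->
  (theta (x - t *: delta_mx 0 j + t *: delta_mx 0 k)%R <= al%:E)%E.
Proof.
move=> symt cvx xkj /andP[t0 tjk] xal.
have D0 : 0 < x 0 j - x 0 k by rewrite subr_gt0.
pose mu := t / (x 0 j - x 0 k).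
have tE : t = mu * (x 0 j - x 0 k) by rewrite /mu mulfVK // gt_eqF.
have mu0 : 0 < mu by rewrite divr_gt0.
have mu1 : mu < 1 by rewrite ltr_pdivrMr // mul1r.
have jk : j != k by apply: contraTneq xkj => ->; rewrite ltxx.
have := cvx x (col_perm (tperm j k) x) I I (1 - mu) _ al al xal.
rewrite sym_fun_col_perm // => /(_ _ xal).
have -> : 0 < 1 - mu < 1 by apply/andP; split; lra.
move=> /(_ isT); have -> : (1 - mu) * al + (1 - (1 - mu)) * al = al by ring.
congr (_ <= _)%E; congr (theta _); apply/rowP => i.
rewrite !(mxDE, mxNE, mxZE) !mxE eqxx /=.
case: tpermP => [->|->|/eqP/negPf ij /eqP/negPf ik].
- by rewrite eqxx (negPf jk) /= tE; ring.
- by rewrite eqxx eq_sym (negPf jk) /= tE; ring.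
- by rewrite ij ik /=; ring.
Qed.

(** Induction on the number of coordinates where [x] and [y] differ. A transfer from the last
    surplus [j] before the first deficit [k], as large as both allow, settles one of them and keeps
    the prefix sums nonnegative. *)
Lemma convex_sym_majorization theta x y (al : R) :
  sym_fun theta -> convex_on [set: 'rV[R]_n] theta -> nonincr y ->
  (forall m, 0 <= prefix_sum (fun i => x 0 i - y 0 i) m) ->
  \sum_i (x 0 i - y 0 i) = 0 ->
  (theta x <= al%:E)%E -> (theta y <= al%:E)%E.
Proof.
move=> symt cvx yn.
have [N] := ubnP #|[set i | x 0 i != y 0 i]%SET|.
elim: N x => // N IH x; rewrite ltnS => xN ps tot xal.
have [<-//|xy] := eqVneq x y.
pose lo := [pred i : 'I_n | x 0 i < y 0 i].
pose hi := [pred i : 'I_n | y 0 i < x 0 i].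
have [i0 i0lo] : exists i, lo i.
  apply: contrapT => nlo; move/eqP: xy; apply; apply/rowP => i.
  have ge0 j : 0 <= x 0 j - y 0 j.
    by rewrite subr_ge0 leNgt; apply/negP => h; apply: nlo; exists j.
  move/psumr_eq0P: tot => /(_ (fun i _ => ge0 i) i isT) /eqP.
  by rewrite subr_eq0 => /eqP.
case: (@arg_minnP _ i0 lo (@nat_of_ord n) i0lo) => k klo kmin.
(* Otherwise the prefix sum up to and including [k] would be negative. *)
have [j0 j0hi] : exists j, hi j && (j < k)%N.
  apply: contrapT => nhi; have := ps k.+1; rewrite prefix_sumS.
  have : prefix_sum (fun i => x 0 i - y 0 i) k <= 0.
    rewrite /prefix_sum sumr_le0 // => i ik; rewrite subr_le0 leNgt; apply/negP => h.
    by apply: nhi; exists i; rewrite /= h ik.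
  by move: klo => /= klo; lra.
case: (@arg_maxnP _ j0 [pred j | hi j && (j < k)%N] (@nat_of_ord n) j0hi) =>
  j /= /andP[jhi jk] jmax.
have between (i : 'I_n) : (j < i)%N -> (i < k)%N -> x 0 i = y 0 i.
  move=> ji ik; apply/eqP; rewrite eq_le; apply/andP; split; rewrite leNgt; apply/negP => h.
    by have := jmax i; rewrite h ik => /(_ isT) /=; rewrite leqNgt ji.
  by have := kmin i h; rewrite leqNgt ik.
have yjk : y 0 k <= y 0 j by apply: yn; exact: ltnW.
move: klo => /= klo.
pose t := Num.min (x 0 j - y 0 j) (y 0 k - x 0 k).
have t0 : 0 < t by rewrite lt_min !subr_gt0 jhi.
have tj : t <= x 0 j - y 0 j by rewrite ge_min lexx.
have tk : t <= y 0 k - x 0 k by rewrite ge_min lexx orbT.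
pose x' := x - t *: delta_mx 0 j + t *: delta_mx 0 k.
have jNk : j != k by rewrite neq_ltn jk.
have x'E i : x' 0 i = x 0 i - (i == j)%:R * t + (i == k)%:R * t.
  by rewrite /x' !(mxDE, mxNE, mxZE) !mxE eqxx /= ![t * _]mulrC.
have x'al : (theta x' <= al%:E)%E.
  apply: transfer_le => //; first lra.
  by apply/andP; split=> //; lra.
apply: (IH x') => //.
- apply: leq_trans xN; apply: proper_card; apply/properP; split.
    apply/fintype.subsetP => i; rewrite !inE x'E.
    have [->|ij] := eqVneq i j; first by move=> _; rewrite gt_eqF.
    have [->|ik] := eqVneq i k; first by move=> _; rewrite lt_eqF.
    by rewrite !mul0r subr0 addr0.
  have [h|h] := leP (x 0 j - y 0 j) (y 0 k - x 0 k).
    exists j; rewrite inE; first by rewrite gt_eqF.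
    rewrite negbK x'E eqxx (negPf jNk) mul0r mul1r addr0.
    by rewrite /t (min_idPl h) opprB addrC subrK eqxx.
  exists k; rewrite inE; first by rewrite lt_eqF.
  rewrite negbK x'E eqxx eq_sym [k == j]eq_sym (negPf jNk) mul0r mul1r subr0.
  by rewrite /t (min_idPr (ltW h)) addrC subrK eqxx.
- have psE m : prefix_sum (fun i => x' 0 i - y 0 i) m =
      prefix_sum (fun i => x 0 i - y 0 i) m - (j < m)%N%:R * t + (k < m)%N%:R * t.
    have one (a : 'I_n) : \sum_(i < n | (i < m)%N) (i == a)%:R * t = (a < m)%N%:R * t.
      rewrite big_mkcond (bigD1 a) //= eqxx big1 ?addr0 => [|i ia].
        by case: (a < m)%N; rewrite ?mul0r.
      by rewrite (negPf ia) mul0r; case: ifP.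
    rewrite -!one /prefix_sum -sumrB -big_split /=; apply: eq_bigr => i _.
    by rewrite x'E; ring.
  move=> m; rewrite psE; have [jm|jm] := ltnP j m; last first.
    have -> : (k < m)%N = false by rewrite ltnNge (leq_trans jm (ltnW jk)).
    by rewrite !mul0r subr0 addr0.
  have [km|km] := ltnP k m; first by rewrite subrK.
  rewrite mul0r addr0 mul1r.
  (* For [j < m <= k] the entries between cancel, and the prefix sum through [j] is at least
     [x 0 j - y 0 j >= t]. *)
  have -> : prefix_sum (fun i => x 0 i - y 0 i) m =
      prefix_sum (fun i => x 0 i - y 0 i) j.+1.
    rewrite /prefix_sum [LHS]big_mkcond [RHS]big_mkcond; apply: eq_bigr => i _ /=.
    rewrite ltnS; have [ij|ij] := leqP i j; first by rewrite (leq_ltn_trans ij jm).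
    case: ifP => // im; rewrite between ?subrr //; exact: leq_trans im km.
  by rewrite prefix_sumS; have := ps j; lra.
- rewrite -[RHS]tot -!prefix_sum_all.
  have : \sum_i (x' 0 i - y 0 i) = \sum_i (x 0 i - y 0 i).
    transitivity (\sum_i ((x 0 i - y 0 i) - (i == j)%:R * t + (i == k)%:R * t)).
      by apply: eq_bigr => i _; rewrite x'E; ring.
    have one (a : 'I_n) : \sum_(i < n) (i == a)%:R * t = t.
      rewrite (bigD1 a) //= eqxx mul1r big1 ?addr0 // => i ia.
      by rewrite (negPf ia) mul0r.
    by rewrite big_split sumrB /= !one subrK.
  by rewrite !prefix_sum_all.
Qed.

(** Supplies the shift in Ky Fan's inequality. The last of the first [m] entries serves as [tau];
    [|l|] or its opposite when [m = 0] or [m > n]. *)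
Lemma nonincr_threshold (l : 'rV[R]_n) m : nonincr l -> exists tau : R,
  forall j : 'I_n, ((j < m)%N -> tau <= l 0 j) /\ ((m <= j)%N -> l 0 j <= tau).
Proof.
move=> ln; case: m => [|m].
  by exists `|l| => j; split=> // _; rewrite (le_trans (ler_norm _)) // mx_entry_le.
have [mn|mn] := ltnP m n.
  by exists (l 0 (Ordinal mn)) => j; split=> [|/ltnW] jm; exact: ln.
exists (- `|l|) => j; split=> jm.
  by rewrite lerNl (le_trans (ler_norm _)) // normrN mx_entry_le.
by have := leq_trans (ltn_ord j) (leq_trans mn (ltnW jm)); rewrite ltnn.
Qed.

(** The diagonal of [V *m A *m V^T] averages the eigenvalues with weights [O i j ^+ 2], whose row
    and column sums are 1. The first [m] rows give [l 0 j] a total weight [w j] in [[0, 1]]; moving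
    weight to the leading eigenvalues can only increase the sum. *)
Lemma ky_fan V A m : symmx A -> V *m V^T = 1%:M ->
  prefix_sum (fun i => (V *m A *m V^T) i i) m <= prefix_sum (fun i => eigvals A 0 i) m.
Proof.
move=> sA VV; have [ln [W [WW AE]]] := eigvalsP sA.
set l := eigvals A in ln AE *.
have [O OE] : exists O, V *m W = O by eexists.
have OO : O *m O^T = 1%:M.
  by rewrite -OE trmx_mul mulmxA -[V *m W *m W^T]mulmxA WW mulmx1.
have diagE i : (V *m A *m V^T) i i = \sum_j O i j ^+ 2 * l 0 j.
  rewrite AE !mulmxA -[_ *m W^T *m V^T]mulmxA -trmx_mul OE mxE.
  by apply: eq_bigr => j _; rewrite mul_mx_diag !mxE; ring.
pose w j := prefix_sum (fun i => O i j ^+ 2) m.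
have w0 j : 0 <= w j by apply: sumr_ge0 => i _; rewrite sqr_ge0.
have w1 j : w j <= 1.
  have /matrixP/(_ j j) := mulmx1C OO; rewrite !mxE eqxx mulr1n => <-.
  rewrite /w /prefix_sum big_mkcond; apply: ler_sum => i _ /=; rewrite mxE.
  by case: ifP => _; rewrite -expr2 ?sqr_ge0.
have wsum : \sum_j w j = \sum_(j < n) (j < m)%N%:R.
  rewrite exchange_big /= big_mkcond; apply: eq_bigr => i _ /=.
  case: ifP => // _; have /matrixP/(_ i i) := OO; rewrite !mxE eqxx mulr1n => <-.
  by apply: eq_bigr => j _; rewrite mxE expr2.
have -> : prefix_sum (fun i => (V *m A *m V^T) i i) m = \sum_j w j * l 0 j.
  rewrite /prefix_sum; under eq_bigr => i _ do rewrite diagE.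
  by rewrite exchange_big; apply: eq_bigr => j _; rewrite /w /prefix_sum mulr_suml.
have -> : prefix_sum (fun i => l 0 i) m = \sum_(j < n) (j < m)%N%:R * l 0 j.
  rewrite /prefix_sum big_mkcond; apply: eq_bigr => i _ /=.
  by case: ifP; rewrite ?mul1r ?mul0r.
have [tau tauP] := nonincr_threshold m ln.
rewrite -subr_ge0 -sumrB.
(* Both weightings have the same total, so subtracting [tau] changes nothing and makes every summand
   nonnegative. *)
have -> : \sum_(i < n) ((i < m)%N%:R * l 0 i - w i * l 0 i) =
    \sum_(i < n) ((i < m)%N%:R - w i) * (l 0 i - tau).
  have h : \sum_(i < n) ((i < m)%N%:R - w i) * tau = 0.
    by rewrite -mulr_suml sumrB wsum subrr mul0r.
  transitivity (\sum_(i < n) ((i < m)%N%:R * l 0 i - w i * l 0 i) -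
    \sum_(i < n) ((i < m)%N%:R - w i) * tau); first by rewrite h subr0.
  by rewrite -sumrB; apply: eq_bigr => i _; ring.
apply: sumr_ge0 => i _; have [h1 h2] := tauP i; have [im|im] := ltnP i m.
  by rewrite mulr_ge0 // subr_ge0 ?w1 ?h1.
by rewrite mulr_le0 // ?sub0r ?oppr_le0 ?w0 // subr_le0 h2.
Qed.

Lemma trace_conj V A : symmx A -> V *m V^T = 1%:M ->
  \sum_i (V *m A *m V^T) i i = \sum_i eigvals A 0 i.
Proof.
move=> sA VV; have [_ [W [WW AE]]] := eigvalsP sA.
have -> : \sum_i (V *m A *m V^T) i i = \tr A.
  by rewrite -[LHS]/(\tr _) mxtrace_mulC mulmxA (mulmx1C VV) mul1mx.
by rewrite {1}AE mxtrace_mulC mulmxA (mulmx1C WW) mul1mx mxtrace_diag.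
Qed.

(** In an eigenbasis of [C = m A + (1 - m) B] the eigenvalues of [C] are the same combination of the
    diagonals of [A] and [B]; Ky Fan bounds their prefix sums and the traces fix the totals. *)
Lemma spectral_convex theta : sym_fun theta -> convex_on [set: 'rV[R]_n] theta ->
  convex_on (@symmx R n) (theta \o @eigvals R n).
Proof.
move=> symt cvx A B sA sB m m01 al be /= Aal Bbe.
set C := m *: A + (1 - m) *: B.
have sC : symmx C by apply: symmx_add; exact: symmx_scale.
have [cn [U [UU CE]]] := eigvalsP sC.
have cE i : eigvals C 0 i =
    m * (U^T *m A *m U^T^T) i i + (1 - m) * (U^T *m B *m U^T^T) i i.
  have <- : (U^T *m C *m U^T^T) i i = eigvals C 0 i.
    rewrite trmxK {1}CE !mulmxA (mulmx1C UU) mul1mx -mulmxA (mulmx1C UU) mulmx1.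
    by rewrite mxE eqxx mulr1n.
  by rewrite mulmxDr mulmxDl -!(scalemxAl, scalemxAr) !mxDE !mxZE.
have UT : U^T *m U^T^T = 1%:M by rewrite trmxK (mulmx1C UU).
have /andP[m0 m1] := m01.
apply: (@convex_sym_majorization _ (m *: eigvals A + (1 - m) *: eigvals B)) => //.
- move=> k; have -> : prefix_sum (fun i => (m *: eigvals A + (1 - m) *: eigvals B) 0 i
        - eigvals C 0 i) k =
      m * (prefix_sum (fun i => eigvals A 0 i) k
        - prefix_sum (fun i => (U^T *m A *m U^T^T) i i) k) +
      (1 - m) * (prefix_sum (fun i => eigvals B 0 i) k
        - prefix_sum (fun i => (U^T *m B *m U^T^T) i i) k).
    rewrite /prefix_sum -!sumrB !mulr_sumr -big_split /=; apply: eq_bigr => i _.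
    by rewrite cE !(mxDE, mxZE); ring.
  rewrite addr_ge0 // mulr_ge0 ?subr_ge0 ?ky_fan // ltW //.
- have -> : \sum_i ((m *: eigvals A + (1 - m) *: eigvals B) 0 i - eigvals C 0 i) =
      m * (\sum_i eigvals A 0 i - \sum_i (U^T *m A *m U^T^T) i i) +
      (1 - m) * (\sum_i eigvals B 0 i - \sum_i (U^T *m B *m U^T^T) i i).
    rewrite -!sumrB !mulr_sumr -big_split /=; apply: eq_bigr => i _.
    by rewrite cE !(mxDE, mxZE); ring.
  by rewrite !trace_conj // !subrr !mulr0 addr0.
- exact: cvx.
Qed.
End SpectralConvexity.

(** * Lower limits, parabolic quotients, convexity of the parabolic subderivative *)

Section LowerLimits.
Variable R : realType.

Lemma cvg_seqP (E : normedModType R) (u : nat -> E) l :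
  u @ \oo --> l <-> forall e : R, 0 < e -> exists N, forall k, (N <= k)%N -> `|u k - l| < e.
Proof.
split=> [/cvgrPdist_lt cu e e0|cu].
  by have [N _ NP] := cu e e0; exists N => k Nk; rewrite distrC; exact: NP.
apply/cvgrPdist_lt => e e0; have [N NP] := cu e e0.
by exists N => // k /= Nk; rewrite distrC; exact: NP.
Qed.

(** Common shape of [subderiv] and [para_subderiv], with the quotient [q] left abstract. *)
Definition liminf_at (E : normedModType R) (S : set E) (q : R -> E -> \bar R) (w0 : E) :=
  ereal_sup [set ereal_inf
     [set y | exists (t : R) (w : E), 0 < t < d /\ `|w - w0| < d /\ S w /\
                y = q t w] | d in [set d : R | 0 < d]].

Lemma liminf_at_le (E E' : normedModType R) (S : set E) (S' : set E') q q' w w' :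
  (forall d : R, 0 < d -> exists2 e : R, 0 < e & forall t v, 0 < t < e -> `|v - w| < e ->
    S v -> exists v', [/\ `|v' - w'| < d, S' v' & q' t v' = q t v]) ->
  (liminf_at S' q' w' <= liminf_at S q w)%E.
Proof.
move=> H; apply: ge_ereal_sup => _ [d /= d0 <-].
have [e e0 eP] := H d d0; pose e' := Num.min e d.
have e'0 : 0 < e' by rewrite lt_min e0.
apply: le_trans (ereal_sup_ubound _); last by exists e'.
apply: le_ereal_inf => _ [t [v [/andP[t0 te] [vw [Sv ->]]]]].
move: te vw; rewrite !lt_min => /andP[te td] /andP[ve vd].
have [|v' [v'd S'v' <-]] := eP t v _ ve Sv; first by rewrite t0.
by exists t, v'; rewrite t0.
Qed.

Lemma liminf_at_leP (E : normedModType R) (S : set E) q w (c : \bar R) :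
  (forall d : R, 0 < d -> exists t v, [/\ 0 < t < d, `|v - w| < d, S v & (q t v <= c)%E]) ->
  (liminf_at S q w <= c)%E.
Proof.
move=> H; apply: ge_ereal_sup => _ [d /= d0 <-].
have [t [v [td vd Sv qc]]] := H d d0.
by apply: le_trans qc; apply: ereal_inf_lbound; exists t, v.
Qed.

Lemma liminf_at_lty (E : normedModType R) (S : set E) q w (d : R) :
  (liminf_at S q w < +oo)%E -> 0 < d ->
  exists t v, [/\ 0 < t < d, `|v - w| < d, S v & (q t v < +oo)%E].
Proof.
move=> loo d0.
pose A := [set y : \bar R | exists (t : R) (v : E), 0 < t < d /\ `|v - w| < d /\ S v /\
                y = q t v].
have : (ereal_inf A < +oo)%E.
  by apply: le_lt_trans loo; apply: ereal_sup_ubound; exists d.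
move/ereal_inf_lt => [_ [t [v [td [vd [Sv ->]]]]] qoo].
by exists t, v.
Qed.

Lemma subderivE (E : normedModType R) (S : set E) f x w :
  subderiv S f x w = liminf_at S (fun t v => ((f (x + t *: v)%R - f x) * (t^-1)%:E)%E) w.
Proof. by []. Qed.

Lemma para_subderivE (E : normedModType R) (S : set E) f x w z :
  para_subderiv S f x w z = liminf_at S (fun t v => para_quot S f x w v t) z.
Proof. by []. Qed.

(** Clears the denominator in the extended reals; an infinite value of [f] satisfies both sides or
    neither. *)
Lemma para_quot_le (E : normedModType R) (S : set E) f x w z (t r0 r1 c : R) :
  f x = r0%:E -> subderiv S f x w = r1%:E -> 0 < t ->
  (para_quot S f x w z t <= c%:E)%E =
  (f (x + t *: w + (t ^+ 2 / 2) *: z)%R <= (r0 + t * r1 + t ^+ 2 / 2 * c)%:E)%E.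
Proof.
move=> fx sw t0; rewrite /para_quot fx sw.
have t2 : 0 < t ^+ 2 / 2 by rewrite divr_gt0 // exprn_gt0.
rewrite lee_pdivrMr //.
case: (f _) => [r| |] //=.
- rewrite -!EFinD -EFinM !lee_fin.
  by apply/idP/idP => h; lra.
- by rewrite !addNye !leNye.
Qed.

Lemma para_quot_lty (E : normedModType R) (S : set E) f x w z (t r0 r1 : R) :
  f x = r0%:E -> subderiv S f x w = r1%:E -> 0 < t ->
  (para_quot S f x w z t < +oo)%E -> (f (x + t *: w + (t ^+ 2 / 2) *: z)%R < +oo)%E.
Proof.
move=> fx sw t0; rewrite /para_quot fx sw.
have t2 : 0 < (t ^+ 2 / 2)^-1 by rewrite invr_gt0 divr_gt0 // exprn_gt0.
by case: (f _) => [r| |] //=; rewrite ?ltry // gt0_mulye ?lte_fin.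
Qed.

Lemma cvg_ereal_eventually_le (u : nat -> \bar R) l (c e : R) : u @ \oo --> l ->
  (l <= c%:E)%E -> 0 < e -> exists N, forall k, (N <= k)%N -> (u k <= (c + e)%:E)%E.
Proof.
move=> ul lc e0.
have lce : (l < (c + e)%:E)%E by apply: le_lt_trans lc _; rewrite lte_fin ltrDl.
have /ul[N _ NP] : nbhs l [set y | (y < (c + e)%:E)%E].
  by apply: open_nbhs_nbhs; split=> //; exact: open_ereal_lt_ereal.
by exists N => k Nk; apply: ltW; exact: NP.
Qed.

Lemma harmonic_eventually_lt (d : R) : 0 < d ->
  exists N, forall k, (N <= k)%N -> (k.+1%:R^-1 : R) < d.
Proof.
move=> d0; have [N NP] := (cvg_seqP (fun k => k.+1%:R^-1 : R^o) 0).1 (@cvg_harmonic R) d d0.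
by exists N => k /NP; rewrite subr0 ger0_norm // invr_ge0.
Qed.

(** Recovery sequences for [a] and [b] along the same [tk] give test points whose convex combination
    is the test point of the combined direction. *)
Lemma para_epi_convex (E : normedModType R) (S : set E) f x w :
  (forall a b, S a -> S b -> S (a + b)) -> (forall (c : R) a, S a -> S (c *: a)) ->
  S x -> S w -> f x \is a fin_num ->
  convex_on S f -> para_epi_for S f x w -> convex_on S (para_subderiv S f x w).
Proof.
move=> SD SZ Sx Sw /fineK fx cvx [/fineK sw [_ rec]] a b Sa Sb m m01 al be aal bbe.
have /andP[m0 m1] := m01.
apply/lee_addgt0Pr => e e0; rewrite -EFinD.
pose tk (k : nat) : R := k.+1%:R^-1.
have tk0 k : 0 < tk k by rewrite invr_gt0.
have tkc : tk @ \oo --> (0 : R) by exact: cvg_harmonic.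
have [ak [Sak [akc aq]]] := rec a Sa tk tk0 tkc.
have [bk [Sbk [bkc bq]]] := rec b Sb tk tk0 tkc.
have [N1 N1P] := cvg_ereal_eventually_le aq aal e0.
have [N2 N2P] := cvg_ereal_eventually_le bq bbe e0.
apply: liminf_at_leP => d d0.
have [N3 N3P] := (cvg_seqP _ _).1 akc d d0.
have [N4 N4P] := (cvg_seqP _ _).1 bkc d d0.
have [N5 N5P] := harmonic_eventually_lt d0.
pose k := maxn N1 (maxn N2 (maxn N3 (maxn N4 N5))).
have {N1P} qa := N1P k (leq_maxl _ _).
have {N2P} qb : (para_quot S f x w (bk k) (tk k) <= (be + e)%:E)%E.
  by apply: N2P; rewrite /k !leq_max leqnn !orbT.
have {N3P} da : `|ak k - a| < d by apply: N3P; rewrite /k !leq_max leqnn !orbT.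
have {N4P} db : `|bk k - b| < d by apply: N4P; rewrite /k !leq_max leqnn !orbT.
have {N5P} dt : tk k < d by apply: N5P; rewrite /k !leq_max leqnn !orbT.
exists (tk k), (m *: ak k + (1 - m) *: bk k); split.
- by rewrite tk0.
- have -> : m *: ak k + (1 - m) *: bk k - (m *: a + (1 - m) *: b) =
      m *: (ak k - a) + (1 - m) *: (bk k - b).
    by rewrite !scalerBr opprD addrACA.
  rewrite (le_lt_trans (ler_normD _ _)) // !normrZ !gtr0_norm ?subr_gt0 //.
  have h1 : m * `|ak k - a| < m * d by rewrite ltr_pM2l.
  have h2 : (1 - m) * `|bk k - b| < (1 - m) * d by rewrite ltr_pM2l // subr_gt0.
  lra.
- by apply: SD; exact: SZ.
- move: qa qb; rewrite !(para_quot_le _ _ (esym fx) (esym sw) (tk0 k)) => qa qb.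
  set t := tk k in qa qb *.
  set r0 := fine (f x) in qa qb *; set r1 := fine _ in qa qb *.
  have Sy v : S v -> S (x + t *: w + (t ^+ 2 / 2) *: v).
    by move=> Sv; apply: (SD); [apply: (SD) => //|]; exact: (SZ).
  have := cvx _ _ (Sy _ (Sak k)) (Sy _ (Sbk k)) m m01 _ _ qa qb.
  have -> : m *: (x + t *: w + (t ^+ 2 / 2) *: ak k) +
       (1 - m) *: (x + t *: w + (t ^+ 2 / 2) *: bk k) =
      x + t *: w + (t ^+ 2 / 2) *: (m *: ak k + (1 - m) *: bk k).
    move: (x + t *: w) => y.
    rewrite [m *: (_ + _)]scalerDr [(1 - m) *: (_ + _)]scalerDr addrACA -scalerDl.
    rewrite subrKC scale1r [RHS]addrC [LHS]addrC scalerDr !scalerA.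
    by rewrite ![_ * (t ^+ 2 / 2)]mulrC.
  move=> h; apply: le_trans h _; rewrite lee_fin; lra.
Qed.
End LowerLimits.

(** * Transfer of subderivatives and recovery sequences between [theta] and [theta \o eigvals] *)

Section SpectralTransfer.
Variables (R : realType) (n : nat) (theta : 'rV[R]_n -> \bar R).
Hypothesis symt : sym_fun theta.
Implicit Types (X H W Y U : 'M[R]_n) (x v : 'rV[R]_n).
Local Notation F := (theta \o @eigvals R n).

Lemma spectral_conj_diag U x : U *m U^T = 1%:M ->
  theta (eigvals (U *m diag_mx x *m U^T)) = theta x.
Proof.
move=> UU; have [s sP] := lex_sort x 0 0.
have VV : U^T *m U^T^T = 1%:M by rewrite trmxK (mulmx1C UU).
have dA : U^T *m (U *m diag_mx x *m U^T) *m U^T^T = diag_mx x.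
  by rewrite trmxK !mulmxA (mulmx1C UU) mul1mx -mulmxA (mulmx1C UU) mulmx1.
rewrite (@eigvalsE _ _ _ (col_perm s x)) ?sym_fun_col_perm //.
apply: conj_is_eigvals (row_perm_orthogonal s VV) (row_perm_conj s dA) _.
by move=> i j /sP /orP[/ltW //|/andP[/eqP -> _]].
Qed.

(** The eigenbasis of [Y0 + r *: W] is kept and its eigenvalues are replaced by [l0 + r *: v]; the
    correction is divided by [r], whence [r^-1] in the bound. *)
Lemma spectral_lift Y0 W (r : R) l0 l1 v : symmx Y0 -> symmx W -> 0 < r ->
  exists W', [/\ symmx W', theta (eigvals (Y0 + r *: W')) = theta (l0 + r *: v) &
    `|W' - W| <= n%:R ^+ 2 *
      (`|v - l1| + r^-1 * `|eigvals (Y0 + r *: W) - (l0 + r *: l1)|)].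
Proof.
move=> sY0 sW r0.
have sY : symmx (Y0 + r *: W) by apply: symmx_add => //; exact: symmx_scale.
have [_ [U [UU YE]]] := eigvalsP sY.
set x := l0 + r *: v; set l := eigvals _ in YE *.
pose D := U *m diag_mx (x - l) *m U^T.
have sD : symmx D by rewrite /symmx !trmx_mul trmxK tr_diag_mx mulmxA.
exists (W + r^-1 *: D); split.
- by apply: symmx_add => //; exact: symmx_scale.
- rewrite scalerDr scalerA mulfV ?gt_eqF // scale1r addrA YE -mulmxDl -mulmxDr.
  by rewrite -linearD /= addrC subrK spectral_conj_diag.
rewrite addrC addKr normrZ gtr0_norm ?invr_gt0 //.
have h1 : `|D| <= n%:R ^+ 2 * `|x - l|.
  apply: (le_trans (orthogonal_conj_norm _ UU)).
  by rewrite ler_wpM2l ?exprn_ge0 // mx_norm_diag.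
have h2 : `|x - l| <= r * `|v - l1| + `|l - (l0 + r *: l1)|.
  have -> : x - l = r *: (v - l1) - (l - (l0 + r *: l1)).
    by apply/matrixP => i j; rewrite !(mxDE, mxNE, mxZE); ring.
  by rewrite (le_trans (ler_normB _ _)) // lerD2r normrZ gtr0_norm.
have h3 : `|v - l1| + r^-1 * `|l - (l0 + r *: l1)| =
    r^-1 * (r * `|v - l1| + `|l - (l0 + r *: l1)|).
  by rewrite mulrDr mulKf // gt_eqF.
rewrite h3 mulrCA; apply: ler_wpM2l; first by rewrite invr_ge0 ltW.
by apply: (le_trans h1); rewrite ler_wpM2l // exprn_ge0.
Qed.

Lemma half_budget (K d : R) : 0 <= K -> 0 < d ->
  exists2 d' : R, 0 < d' & K * (d' + d') < d.
Proof.
move=> K0 d0; have K1 : 0 < K + 1 by rewrite ltr_wpDl.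
exists (d / (2 * (K + 1))); first by rewrite divr_gt0 // mulr_gt0.
have -> : K * (d / (2 * (K + 1)) + d / (2 * (K + 1))) = d * (K / (K + 1)).
  by field; rewrite gt_eqF.
by rewrite gtr_pMr // ltr_pdivrMr // mul1r ltrDl.
Qed.

(* [Y0 t + r t *: W] and [l0 t + r t *: v] are the test points of a difference
   quotient of [F] at a matrix and of [theta] at its eigenvalues. *)
Definition spectral_expansion (Y0 : R -> 'M[R]_n) (l0 : R -> 'rV[R]_n) (r : R -> R)
    W (l1 : 'rV[R]_n) :=
  [/\ forall t, symmx (Y0 t), forall t, 0 < t -> 0 < r t &
  forall d : R, 0 < d -> exists2 e : R, 0 < e & forall t, 0 < t < e ->
    `|eigvals (Y0 t + r t *: W) - (l0 t + r t *: l1)| <= d * r t].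

Section Expansion.
Variables (Y0 : R -> 'M[R]_n) (l0 : R -> 'rV[R]_n) (r : R -> R).
Variables (W : 'M[R]_n) (l1 : 'rV[R]_n).
Hypotheses (sW : symmx W) (expand : spectral_expansion Y0 l0 r W l1).

Lemma spectral_expansion_lift (d : R) : 0 < d ->
  exists2 e : R, 0 < e & forall t v, 0 < t < e -> `|v - l1| < e ->
    exists W', [/\ `|W' - W| < d, symmx W' &
      theta (eigvals (Y0 t + r t *: W')) = theta (l0 t + r t *: v)].
Proof.
case: expand => sY r0 E d0.
have [d' d'0 d'd] := half_budget (exprn_ge0 2 (ler0n R n)) d0.
have [e e0 eP] := E d' d'0; exists (Num.min e d'); first by rewrite lt_min e0.
move=> t v /andP[t0]; rewrite !lt_min => /andP[te _] /andP[_ vd].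
have rt := r0 t t0.
have [W' [sW' tE WW']] := spectral_lift (l0 t) l1 v (sY t) sW rt.
exists W'; split=> //; apply: le_lt_trans WW' _; apply: le_lt_trans d'd.
rewrite ler_wpM2l ?exprn_ge0 // lerD ?(ltW vd) // mulrC ler_pdivrMr //.
by apply: eP; rewrite t0.
Qed.

(** The eigenvalues vary by at most [n%:R ^+ 3 * r t * |W' - W|], so the factor [r t] cancels in the
    rescaled displacement, whatever its order in [t]. *)
Lemma spectral_expansion_push (d : R) : 0 < d ->
  exists2 e : R, 0 < e & forall t W', 0 < t < e -> `|W' - W| < e -> symmx W' ->
    `|(r t)^-1 *: (eigvals (Y0 t + r t *: W') - l0 t) - l1| < d.
Proof.
case: expand => sY r0 E d0.
have K0 : 0 <= n%:R ^+ 3 + 1 :> R by rewrite addr_ge0 // exprn_ge0.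
have [d' d'0 d'd] := half_budget K0 d0.
have [e e0 eP] := E d' d'0.
exists (Num.min e d'); first by rewrite lt_min e0.
move=> t W' /andP[t0]; rewrite !lt_min => /andP[te _] /andP[_ Wd] sW'.
have rt := r0 t t0.
have {eP} := eP t; rewrite t0 te => /(_ isT).
have sY' Z : symmx Z -> symmx (Y0 t + r t *: Z).
  by move=> sZ; apply: symmx_add => //; exact: symmx_scale.
have := eigvals_lipschitz (sY' _ sW') (sY' _ sW).
rewrite opprD addrACA subrr add0r -scalerBr normrZ gtr0_norm //.
set l := eigvals (_ + _ *: W); set l' := eigvals _ => lip ll.
have -> : (r t)^-1 *: (l' - l0 t) - l1 =
    (r t)^-1 *: ((l' - l) + (l - (l0 t + r t *: l1))).
  have {1}-> : l1 = (r t)^-1 *: (r t *: l1) by rewrite scalerA mulVf ?scale1r ?gt_eqF.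
  rewrite -scalerBr; congr (_ *: _); apply/matrixP => i j.
  by rewrite !(mxDE, mxNE, mxZE); ring.
rewrite normrZ gtr0_norm ?invr_gt0 // mulrC ltr_pdivrMr //.
apply: (le_lt_trans (ler_normD _ _)).
have h : n%:R ^+ 3 * (r t * `|W' - W|) <= n%:R ^+ 3 * (r t * d').
  by rewrite ler_wpM2l ?exprn_ge0 // ler_wpM2l ?ltW.
have h1 : (n%:R ^+ 3 + 1) * (d' + d') * r t < d * r t by rewrite ltr_pM2r.
have h2 : 0 <= n%:R ^+ 3 * (r t * d') by rewrite mulr_ge0 ?exprn_ge0 // mulr_ge0 // ltW.
have h3 : 0 < r t * d' by rewrite mulr_gt0.
lra.
Qed.

(** The abstract [g] covers first-order and parabolic quotients alike: apart from [t] and fixed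
    quantities, both involve only the value of the function at the test point. *)
Lemma liminf_at_spectral (g : R -> \bar R -> \bar R) :
  liminf_at (@symmx R n) (fun t V => g t (F (Y0 t + r t *: V))) W =
  liminf_at [set: 'rV[R]_n] (fun t v => g t (theta (l0 t + r t *: v))) l1.
Proof.
have [_ r0 _] := expand.
apply/eqP; rewrite eq_le; apply/andP; split; apply: liminf_at_le => d d0.
  have [e e0 eP] := spectral_expansion_lift d0; exists e => // t v te ve _.
  by have [W' [h1 h2 h3]] := eP t v te ve; exists W'; split=> //=; rewrite h3.
have [e e0 eP] := spectral_expansion_push d0; exists e => // t W' te We sW'.
have /andP[t0 _] := te.
exists ((r t)^-1 *: (eigvals (Y0 t + r t *: W') - l0 t)); split=> //.
  exact: eP.
by rewrite scalerA mulfV ?gt_eqF ?r0 // scale1r subrKC.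
Qed.

Lemma spectral_seq_lift (tk : nat -> R) (vk : nat -> 'rV[R]_n) :
  (forall k, 0 < tk k) -> tk @ \oo --> (0 : R) -> vk @ \oo --> l1 ->
  exists Wk : nat -> 'M[R]_n, [/\ forall k, symmx (Wk k), Wk @ \oo --> W &
    forall k, theta (eigvals (Y0 (tk k) + r (tk k) *: Wk k)) =
              theta (l0 (tk k) + r (tk k) *: vk k)].
Proof.
case: expand => sY r0 E tk0 /cvg_seqP tkc /cvg_seqP vkc.
have /choice[Wk WkP] k := spectral_lift (l0 (tk k)) l1 (vk k) (sY (tk k)) sW (r0 _ (tk0 k)).
exists Wk; split=> [k||k]; [by have [] := WkP k| |by have [] := WkP k].
apply/cvg_seqP => d d0.
have [d' d'0 d'd] := half_budget (exprn_ge0 2 (ler0n R n)) d0.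
have [e e0 eP] := E d' d'0.
have [N1 N1P] := tkc e e0; have [N2 N2P] := vkc d' d'0.
exists (maxn N1 N2) => k; rewrite geq_max => /andP[/N1P h1 /N2P h2].
rewrite subr0 gtr0_norm // in h1.
have [_ _ WW'] := WkP k; apply: le_lt_trans WW' _; apply: le_lt_trans d'd.
rewrite ler_wpM2l ?exprn_ge0 // lerD ?(ltW h2) // mulrC ler_pdivrMr ?r0 //.
by apply: eP; rewrite tk0.
Qed.

Lemma spectral_seq_push (tk : nat -> R) (Wk : nat -> 'M[R]_n) :
  (forall k, 0 < tk k) -> tk @ \oo --> (0 : R) -> Wk @ \oo --> W ->
  (forall k, symmx (Wk k)) ->
  exists vk : nat -> 'rV[R]_n, vk @ \oo --> l1 /\
    forall k, eigvals (Y0 (tk k) + r (tk k) *: Wk k) = l0 (tk k) + r (tk k) *: vk k.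
Proof.
move=> tk0 /cvg_seqP tkc /cvg_seqP Wkc sWk; have [_ r0 _] := expand.
exists (fun k => (r (tk k))^-1 *: (eigvals (Y0 (tk k) + r (tk k) *: Wk k) - l0 (tk k))).
split=> [|k]; last by rewrite scalerA mulfV ?gt_eqF ?r0 // scale1r subrKC.
apply/cvg_seqP => d d0; have [e e0 eP] := spectral_expansion_push d0.
have [N1 N1P] := tkc e e0; have [N2 N2P] := Wkc e e0.
exists (maxn N1 N2) => k; rewrite geq_max => /andP[/N1P h1 /N2P h2].
rewrite subr0 gtr0_norm // in h1.
by apply: eP => //; rewrite tk0.
Qed.
End Expansion.

Lemma para_spectral_expansion X H W : symmx X -> symmx H -> symmx W ->
  spectral_expansion (fun t => X + t *: H)
    (fun t => eigvals X + t *: eig_d1 X H) (fun t => t ^+ 2 / 2) W (eig_d2 X H W).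
Proof.
move=> sX sH sW; split=> [t|t t0|d d0].
- by apply: symmx_add => //; exact: symmx_scale.
- by rewrite divr_gt0 // exprn_gt0.
have [c [e e0 E]] := eigvals_expansion sX sH sW.
have D0 : 0 < 2 * (`|c| + 1) by rewrite mulr_gt0 // ltr_wpDl.
exists (Num.min e (d / (2 * (`|c| + 1)))); first by rewrite lt_min e0 divr_gt0.
move=> t /andP[t0]; rewrite lt_min => /andP[te td].
have {E} := E t; rewrite t0 te => /(_ isT) h; apply: le_trans h _.
rewrite ltr_pdivlMr // in td.
have -> : c * t ^+ 3 = (c * t * 2) * (t ^+ 2 / 2) by field.
apply: ler_wpM2r; first by rewrite divr_ge0 // exprn_ge0 // ltW.
have : c * t <= `|c| * t by rewrite ler_wpM2r ?ler_norm // ltW.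
lra.
Qed.

(** The parabolic expansion with [W = 0], whose quadratic term is absorbed in the error [d * t]. *)
Lemma direct_spectral_expansion X H : symmx X -> symmx H ->
  spectral_expansion (fun=> X) (fun=> eigvals X) id H (eig_d1 X H).
Proof.
move=> sX sH; split=> // d d0.
have [_ _ E] := para_spectral_expansion sX sH (symmx0 R n).
have [e e0 eP] := E 1 ltr01; move: (eig_d2 X H 0) eP => l2 eP {E}.
have D0 : 0 < `|l2| + 1 by rewrite ltr_wpDl.
exists (Num.min e (d / (`|l2| + 1))); first by rewrite lt_min e0 divr_gt0.
move=> t /andP[t0]; rewrite lt_min => /andP[te]; rewrite ltr_pdivlMr // => td.
have {eP} := eP t; rewrite t0 te => /(_ isT); rewrite scaler0 addr0 mul1r => h.
move: (eigvals _) (eigvals X) (eig_d1 X H) h => l lX l1 h.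
have -> : l - (lX + t *: l1) =
   (l - (lX + t *: l1 + (t ^+ 2 / 2) *: l2)) + (t ^+ 2 / 2) *: l2.
  by apply/matrixP => i j; rewrite !(mxDE, mxNE, mxZE); ring.
have t2 : 0 < t ^+ 2 / 2 by rewrite divr_gt0 // exprn_gt0.
rewrite (le_trans (ler_normD _ _)) // normrZ gtr0_norm //.
have : t * (t * (`|l2| + 1)) <= t * d by rewrite ler_pM2l // ltW.
have : 0 <= t ^+ 2 * `|l2| by rewrite mulr_ge0 // sqr_ge0.
have : 0 < t ^+ 2 by rewrite exprn_gt0.
lra.
Qed.

Lemma subderiv_spectral X H : symmx X -> symmx H ->
  subderiv (@symmx R n) F X H = subderiv [set: 'rV[R]_n] theta (eigvals X) (eig_d1 X H).
Proof.
move=> sX sH; rewrite !subderivE.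
exact: (liminf_at_spectral sH (direct_spectral_expansion sX sH)
  (fun t y => ((y - theta (eigvals X)) * (t^-1)%:E)%E)).
Qed.

Lemma para_quot_spectral X H V v t : symmx X -> symmx H ->
  theta (eigvals (X + t *: H + (t ^+ 2 / 2) *: V)) =
    theta (eigvals X + t *: eig_d1 X H + (t ^+ 2 / 2) *: v) ->
  para_quot (@symmx R n) F X H V t =
  para_quot [set: 'rV[R]_n] theta (eigvals X) (eig_d1 X H) v t.
Proof. by move=> sX sH E; rewrite /para_quot /= E subderiv_spectral. Qed.

Lemma para_subderiv_spectral X H W : symmx X -> symmx H -> symmx W ->
  para_subderiv (@symmx R n) F X H W =
  para_subderiv [set: 'rV[R]_n] theta (eigvals X) (eig_d1 X H) (eig_d2 X H W).
Proof.
move=> sX sH sW; rewrite !para_subderivE /para_quot subderiv_spectral //.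
exact: (liminf_at_spectral sW (para_spectral_expansion sX sH sW)
  (fun t y => ((y - theta (eigvals X) - t%:E * subderiv [set: 'rV[R]_n] theta
     (eigvals X) (eig_d1 X H)) * ((t ^+ 2 / 2)^-1)%:E)%E)).
Qed.

Lemma norm_col_perm (s : 'S_n) x : `|col_perm s x| = `|x|.
Proof.
apply/eqP; rewrite eq_le; apply/andP; split; apply: mx_norm_leP => // i j.
  by rewrite mxE mx_entry_le.
by have := mx_entry_le (col_perm s x) i ((s^-1)%g j); rewrite mxE permKV.
Qed.

Lemma col_permD (s : 'S_n) x v : col_perm s (x + v) = col_perm s x + col_perm s v.
Proof. by apply/matrixP => i j; rewrite !mxE. Qed.

Lemma col_permB (s : 'S_n) x v : col_perm s (x - v) = col_perm s x - col_perm s v.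
Proof. by apply/matrixP => i j; rewrite !mxE. Qed.

Lemma col_permZ (s : 'S_n) (a : R) x : col_perm s (a *: x) = a *: col_perm s x.
Proof. by apply/matrixP => i j; rewrite !mxE. Qed.

Lemma col_permK (s : 'S_n) x : col_perm s (col_perm (s^-1)%g x) = x.
Proof. by apply/matrixP => i j; rewrite !mxE permK. Qed.

Lemma col_permKV (s : 'S_n) x : col_perm (s^-1)%g (col_perm s x) = x.
Proof. by apply/matrixP => i j; rewrite !mxE permKV. Qed.

Lemma liminf_at_col_perm (s : 'S_n) (q q' : R -> 'rV[R]_n -> \bar R) x :
  (forall t v, q' t (col_perm s v) = q t v) ->
  liminf_at [set: 'rV[R]_n] q' (col_perm s x) = liminf_at [set: 'rV[R]_n] q x.
Proof.
move=> qq; apply/eqP; rewrite eq_le; apply/andP; split; apply: liminf_at_le => d d0.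
  exists d => // t v _ vd _; exists (col_perm s v); split=> //.
  by rewrite -col_permB norm_col_perm.
exists d => // t v _ vd _; exists (col_perm (s^-1)%g v); split=> //.
  by rewrite -(norm_col_perm s) col_permB col_permK.
by rewrite -qq col_permK.
Qed.

Lemma subderiv_col_perm (s : 'S_n) x v :
  subderiv [set: 'rV[R]_n] theta (col_perm s x) (col_perm s v) =
  subderiv [set: 'rV[R]_n] theta x v.
Proof.
rewrite !subderivE; apply: liminf_at_col_perm => t w.
by rewrite -col_permZ -col_permD !sym_fun_col_perm.
Qed.

Lemma para_quot_col_perm (s : 'S_n) x v z t :
  para_quot [set: 'rV[R]_n] theta (col_perm s x) (col_perm s v) (col_perm s z) t =
  para_quot [set: 'rV[R]_n] theta x v z t.
Proof.
rewrite /para_quot subderiv_col_perm -!col_permZ -!col_permD.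
by rewrite !sym_fun_col_perm.
Qed.

Lemma para_subderiv_col_perm (s : 'S_n) x v z :
  para_subderiv [set: 'rV[R]_n] theta (col_perm s x) (col_perm s v) (col_perm s z) =
  para_subderiv [set: 'rV[R]_n] theta x v z.
Proof.
rewrite !para_subderivE; apply: liminf_at_col_perm => t w; exact: para_quot_col_perm.
Qed.

Lemma cvg_col_perm (s : 'S_n) (u : nat -> 'rV[R]_n) l : u @ \oo --> l ->
  (fun k => col_perm s (u k) : 'rV[R]_n) @ \oo --> (col_perm s l : 'rV[R]_n).
Proof.
move=> /cvg_seqP ul; apply/cvg_seqP => e /ul[N NP]; exists N => k /NP.
by rewrite -col_permB norm_col_perm.
Qed.

Lemma para_epi_for_col_perm (s : 'S_n) x v :
  para_epi_for [set: 'rV[R]_n] theta (col_perm s x) (col_perm s v) ->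
  para_epi_for [set: 'rV[R]_n] theta x v.
Proof.
move=> [fin [[z [_ zoo]] rec]]; split; first by rewrite -(subderiv_col_perm s).
split.
  exists (col_perm (s^-1)%g z); split; first exact: I.
  by rewrite -(para_subderiv_col_perm s) col_permK.
move=> w _ tk tk0 tkc; have [zk [_ [zkc qc]]] := rec (col_perm s w) I tk tk0 tkc.
exists (fun k => col_perm (s^-1)%g (zk k)); split; [by [] | split].
  by rewrite -(col_permKV s w); exact: cvg_col_perm.
rewrite -(para_subderiv_col_perm s).
have -> : (fun k => para_quot [set: 'rV[R]_n] theta x v (col_perm (s^-1)%g (zk k)) (tk k)) =
    (fun k => para_quot [set: 'rV[R]_n] theta (col_perm s x) (col_perm s v) (zk k) (tk k)).
  by apply/funext => k; rewrite -(para_quot_col_perm s) col_permK.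
exact: qc.
Qed.

Lemma para_epi_for_spectral X H : symmx X -> symmx H ->
  para_epi_for [set: 'rV[R]_n] theta (eigvals X) (eig_d1 X H) ->
  para_epi_for (@symmx R n) F X H.
Proof.
move=> sX sH [fin [[z [_ zoo]] rec]]; split; first by rewrite subderiv_spectral.
split.
  (* A direction of value below [+oo] is lifted up to a permutation, which fixes the base point and
     [eig_d1 X H] and so leaves the parabolic subderivative of [theta] unchanged. *)
  have [W [s [sW E0 E1 E2]]] := eig_d2_surj z sX sH.
  exists W; split; first exact: sW.
  have := para_subderiv_col_perm s (eigvals X) (eig_d1 X H) z.
  by rewrite (para_subderiv_spectral sX sH sW) E2 E0 E1 => ->.
move=> W sW tk tk0 tkc.
have [vk [_ [vkc qc]]] := rec (eig_d2 X H W) I tk tk0 tkc.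
have [Wk [sWk Wkc WkE]] := spectral_seq_lift sW
  (para_spectral_expansion sX sH sW) tk0 tkc vkc.
exists Wk; split; first exact: sWk.
split; first exact: Wkc.
rewrite (para_subderiv_spectral sX sH sW).
have -> : (fun k => para_quot (@symmx R n) F X H (Wk k) (tk k)) =
    (fun k => para_quot [set: 'rV[R]_n] theta (eigvals X) (eig_d1 X H) (vk k) (tk k)).
  by apply/funext => k; exact: para_quot_spectral.
exact: qc.
Qed.

Lemma para_epi_for_of_spectral X H : symmx X -> symmx H ->
  para_epi_for (@symmx R n) F X H ->
  para_epi_for [set: 'rV[R]_n] theta (eigvals X) (eig_d1 X H).
Proof.
move=> sX sH [fin [[W [sW Woo]] rec]]; split; first by rewrite -subderiv_spectral.
split.
  exists (eig_d2 X H W); split; first exact: I.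
  by rewrite -(para_subderiv_spectral sX sH sW).
move=> z _ tk tk0 tkc.
(* [z] is realised up to [s]; a recovery sequence for [V] is pushed to the eigenvalues and then
   permuted back. *)
have [V [s [sV E0 E1 E2]]] := eig_d2_surj z sX sH.
have [Wk [sWk [Wkc qc]]] := rec V sV tk tk0 tkc.
have [vk [vkc vkE]] := spectral_seq_push sV (para_spectral_expansion sX sH sV)
  tk0 tkc Wkc sWk.
have paraE : para_subderiv (@symmx R n) F X H V =
    para_subderiv [set: 'rV[R]_n] theta (eigvals X) (eig_d1 X H) z.
  have := para_subderiv_col_perm s (eigvals X) (eig_d1 X H) z.
  by rewrite (para_subderiv_spectral sX sH sV) E2 E0 E1.
exists (fun k => col_perm (s^-1)%g (vk k)); split; [by [] | split].
  by rewrite -(col_permKV s z) -E2; exact: cvg_col_perm.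
rewrite -paraE.
have -> : (fun k => para_quot [set: 'rV[R]_n] theta (eigvals X) (eig_d1 X H)
      (col_perm (s^-1)%g (vk k)) (tk k)) =
    (fun k => para_quot (@symmx R n) F X H (Wk k) (tk k)).
  apply/funext => k; rewrite -(para_quot_col_perm s) E0 E1 col_permK.
  by rewrite -(@para_quot_spectral X H (Wk k)) //= vkE.
exact: qc.
Qed.
End SpectralTransfer.

(** * Domain of the parabolic subderivative and the second-order tangent set *)

Section ParabolicDomain.
Variables (R : realType) (E : normedModType R) (S : set E) (f : E -> \bar R).
Hypothesis SD : forall a b, S a -> S b -> S (a + b).
Hypothesis SZ : forall (c : R) a, S a -> S (c *: a).

Lemma cvg_of_lt_harmonic (E' : normedModType R) (u : nat -> E') l :
  (forall k, `|u k - l| < k.+1%:R^-1) -> u @ \oo --> l.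
Proof.
move=> ul; apply/cvg_seqP => e e0; have [N NP] := harmonic_eventually_lt e0.
by exists N => k Nk; exact: lt_trans (ul k) (NP k Nk).
Qed.

(** A lower limit below [+oo] supplies, for every [k], a test point with step and direction within
    [1/(k+1)] of their limits and with [f] below [+oo] there. *)
Lemma para_dom_tangent2 x w z : S x -> S w -> f x \is a fin_num ->
  subderiv S f x w \is a fin_num -> S z ->
  (para_subderiv S f x w z < +oo)%E -> tangent2 (efdom S f) x w z.
Proof.
move=> Sx Sw /fineK fx /fineK sw Sz zoo.
have /choice[tu tuP] k : exists tu : R * E, [/\ 0 < tu.1 < k.+1%:R^-1,
    `|tu.2 - z| < k.+1%:R^-1, S tu.2 & (para_quot S f x w tu.2 tu.1 < +oo)%E].
  have k0 : 0 < k.+1%:R^-1 :> R by rewrite invr_gt0.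
  by have [t [u P]] := liminf_at_lty zoo k0; exists (t, u).
exists (fun k => (tu k).1), (fun k => (tu k).2); split; [|split; [|split]].
- by move=> k; have [/andP[]] := tuP k.
- apply: (@cvg_of_lt_harmonic R^o) => k; have [/andP[t0 tk] _ _ _] := tuP k.
  by rewrite subr0 gtr0_norm.
- by apply: cvg_of_lt_harmonic => k; have [] := tuP k.
- move=> k; have [/andP[t0 _] _ Su qoo] := tuP k; split.
    by apply: (SD); [apply: (SD) => //|]; exact: (SZ).
  exact: para_quot_lty (esym fx) (esym sw) t0 qoo.
Qed.

(* The values of [f] along the given sequence are compared, by the Lipschitz
   property, with those along a recovery sequence for a point of finite value. *)
Lemma tangent2_para_dom x w z : S x -> S w -> f x \is a fin_num ->
  loc_lip_rel_dom S f -> para_epi_for S f x w -> S z ->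
  tangent2 (efdom S f) x w z -> (para_subderiv S f x w z < +oo)%E.
Proof.
move=> Sx Sw fxfin lip [/fineK sw [[z0 [Sz0 z0oo]] rec]] Sz [tk [uk [tk0 [tkc [ukc domu]]]]].
have fx := fineK fxfin.
have [zk [Szk [zkc qc]]] := rec z0 Sz0 tk tk0 tkc.
have [c cz0] : exists c : R, (para_subderiv S f x w z0 <= c%:E)%E.
  case: (para_subderiv S f x w z0) z0oo => [c _|//|_]; first by exists c.
  by exists 0; rewrite leNye.
have [N1 N1P] := cvg_ereal_eventually_le qc cz0 ltr01.
have dx : efdom S f x by split=> //; rewrite -fx ltry.
have [l [d [d0 lipx]]] := lip x dx.
(* For [0 < t <= 1] and [|v| <= |z| + |z0| + 1] the displacement [t w + (t^2/2) v] is shorter than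
   [t * K], so [t < d / K] keeps it in the Lipschitz ball. *)
pose K := `|w| + `|z0| + `|z| + 2.
have K0 : 0 < K by rewrite ltr_wpDl // !addr_ge0.
(* Eventually [uk] and [zk] are within 1 of [z] and [z0], hence at most [|z| + |z0| + 2] apart; [l]
   may be negative, hence its absolute value. *)
pose L := `|l| * (`|z| + `|z0| + 2).
suff : (para_subderiv S f x w z <= (c + 1 + L)%:E)%E by move/le_lt_trans; apply; exact: ltry.
apply: liminf_at_leP => d' d'0.
have e1 : 0 < Num.min 1 d' by rewrite lt_min ltr01.
have e2 : 0 < Num.min (Num.min 1 d') (d / K) by rewrite lt_min e1 divr_gt0.
have [N2 N2P] := (cvg_seqP (tk : nat -> R^o) 0).1 tkc _ e2.
have [N3 N3P] := (cvg_seqP _ _).1 ukc _ e1.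
have [N4 N4P] := (cvg_seqP _ _).1 zkc 1 ltr01.
pose k := maxn N1 (maxn N2 (maxn N3 N4)).
have {N1P} q0 := N1P k (leq_maxl _ _).
have {N2P} : `|tk k - 0| < Num.min (Num.min 1 d') (d / K).
  by apply: N2P; rewrite /k !leq_max leqnn !orbT.
rewrite subr0 gtr0_norm ?tk0 // !lt_min => /andP[/andP[t1 td'] tdK].
have {N3P} : `|uk k - z| < Num.min 1 d'.
  by apply: N3P; rewrite /k !leq_max leqnn !orbT.
rewrite lt_min => /andP[u1 ud'].
have {N4P} z1 : `|zk k - z0| < 1 by apply: N4P; rewrite /k !leq_max leqnn !orbT.
have t0 := tk0 k; set t := tk k in t0 t1 td' tdK q0 *.
have nz (v v0 : E) : `|v - v0| < 1 -> `|v| <= `|v0| + 1.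
  move=> h; rewrite -[v](subrK v0) addrC (le_trans (ler_normD _ _)) // lerD2l.
  exact: ltW.
have nu := nz _ _ u1; have nzk := nz _ _ z1.
have t2 : 0 < t ^+ 2 / 2 by rewrite divr_gt0 // exprn_gt0.
have t22 : t ^+ 2 / 2 <= t.
  have : t ^+ 2 <= t by rewrite expr2 ler_piMr // ltW.
  by have := exprn_gt0 2 t0; lra.
have near_x (v : E) : `|v| <= `|z| + `|z0| + 1 -> `|x + t *: w + (t ^+ 2 / 2) *: v - x| < d.
  move=> hv; rewrite -[x + _ + _]addrA [x + _]addrC addrK (le_lt_trans (ler_normD _ _)) //.
  rewrite [`|t *: w|]normrZ [`|_ *: v|]normrZ !gtr0_norm //.
  have h1 : t ^+ 2 / 2 * `|v| <= t * `|v| by rewrite ler_wpM2r.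
  have h2 : t * `|v| <= t * (`|z| + `|z0| + 1) by rewrite ler_pM2l.
  rewrite ltr_pdivlMr // /K in tdK; lra.
have [Syu yuoo] := domu k; rewrite -/t in Syu yuoo.
have Suk : S (uk k).
  have -> : uk k = (t ^+ 2 / 2)^-1 *: (x + t *: w + (t ^+ 2 / 2) *: uk k +
      (-1) *: (x + t *: w)).
    by rewrite scaleN1r addrC addKr scalerA mulVf ?scale1r ?gt_eqF.
  by apply: (SZ); apply: (SD) => //; apply: (SZ); apply: (SD) => //; exact: (SZ).
exists t, (uk k); split; [by rewrite t0|by []|by []|].
rewrite (para_quot_le _ _ (esym fx) (esym sw) t0).
move: q0; rewrite (para_quot_le _ _ (esym fx) (esym sw) t0).
set r0 := fine (f x); set r1 := fine _; set b0 := r0 + t * r1 + _.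
set yz := x + t *: w + _ *: zk k => yzb.
set yu := x + t *: w + _ *: uk k in Syu yuoo *.
have dyz : efdom S f yz.
  split; last by apply: le_lt_trans yzb _; exact: ltry.
  by apply: (SD); [apply: (SD) => //|]; exact: (SZ).
have nxu : `|yu - x| < d by apply: near_x; have := normr_ge0 z0; lra.
have nxz : `|yz - x| < d by apply: near_x; have := normr_ge0 z; lra.
have := lipx yu yz (conj Syu yuoo) dyz nxu nxz.
have uz : `|yu - yz| <= t ^+ 2 / 2 * (`|z| + `|z0| + 2).
  rewrite /yu /yz opprD addrACA subrr add0r -scalerBr normrZ (gtr0_norm t2).
  by rewrite ler_pM2l // (le_trans (ler_normB _ _)) //; lra.
have lL : l * `|yu - yz| <= t ^+ 2 / 2 * L.
  apply: (@le_trans _ _ (`|l| * `|yu - yz|)); first by rewrite ler_wpM2r // ler_norm.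
  by rewrite /L mulrCA ler_wpM2l.
case: (f yu) yuoo => [a _|//|_ _]; last by rewrite leNye.
case: (f yz) yzb => [b|//|_ //].
rewrite -EFinB !lee_fin => bb ab.
have := ler_norm (a - b); rewrite /b0 in bb; lra.
Qed.
End ParabolicDomain.

(** * Lipschitz continuity of the spectral function and symmetry of tangent directions *)

Section SpectralTheorem.
Variables (R : realType) (n : nat) (theta : 'rV[R]_n -> \bar R).
Hypothesis symt : sym_fun theta.
Local Notation F := (theta \o @eigvals R n).

Lemma spectral_loc_lip : loc_lip_rel_dom [set: 'rV[R]_n] theta ->
  loc_lip_rel_dom (@symmx R n) F.
Proof.
move=> lip X [sX Xoo]; have [l [d [d0 lipd]]] := lip (eigvals X) (conj I Xoo).
have K0 : 0 < n%:R ^+ 3 + 1 :> R by rewrite ltr_wpDl // exprn_ge0.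
have close A : symmx A -> `|A - X| < d / (n%:R ^+ 3 + 1) -> `|eigvals A - eigvals X| < d.
  move=> sA; rewrite ltr_pdivlMr // => h; apply: le_lt_trans (eigvals_lipschitz sA sX) _.
  by apply: le_lt_trans h; rewrite mulrC ler_wpM2l // lerDl.
exists (`|l| * n%:R ^+ 3), (d / (n%:R ^+ 3 + 1)); split; first by rewrite divr_gt0.
move=> A B [sA Aoo] [sB Boo] /close Ad /close Bd.
apply: le_trans (lipd _ _ (conj I Aoo) (conj I Boo) (Ad sA) (Bd sB)) _.
rewrite lee_fin -mulrA; apply: (@le_trans _ _ (`|l| * `|eigvals A - eigvals B|)).
  by rewrite ler_wpM2r // ler_norm.
by rewrite ler_wpM2l // eigvals_lipschitz.
Qed.

Lemma symmx_cvg (u : nat -> 'M[R]_n) W : (forall k, symmx (u k)) -> u @ \oo --> W -> symmx W.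
Proof.
move=> su /cvg_seqP uW; apply/eqP; rewrite -subr_eq0 -normr_le0.
apply/ler_addgt0Pr => e e0; rewrite add0r.
have [N NP] := uW (e / 2) (divr_gt0 e0 (ltr0Sn _ _)).
have := NP N (leqnn N) => h.
have -> : W^T - W = (u N - W) - (u N - W)^T.
  rewrite trmx_add trmx_opp (su N) opprB.
  by apply/matrixP => i j; rewrite !(mxDE, mxNE); ring.
rewrite (le_trans (ler_normB _ _)) // mx_norm_tr.
have : `|u N - W| < e / 2 by [].
lra.
Qed.

Lemma symmx_of_scaled_sum (X0 W : 'M[R]_n) (a : R) : a != 0 -> symmx X0 ->
  symmx (X0 + a *: W) -> symmx W.
Proof.
move=> a0 sX0 sY; have -> : W = a^-1 *: (X0 + a *: W - X0).
  by rewrite addrC addKr scalerA mulVf ?scale1r.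
by apply: symmx_scale; exact: symmx_sub.
Qed.

(** A tangent direction is a limit of rescaled differences of symmetric matrices. *)
Lemma tangent_cone_symmx (X H : 'M[R]_n) :
  symmx X -> tangent_cone (efdom (@symmx R n) F) X H -> symmx H.
Proof.
move=> sX [tk [wk [tk0 [_ [wkc dom]]]]]; apply: symmx_cvg wkc => k.
by have [+ _] := dom k; apply: symmx_of_scaled_sum => //; rewrite gt_eqF.
Qed.

Lemma tangent2_symmx (X H W : 'M[R]_n) :
  symmx X -> symmx H -> tangent2 (efdom (@symmx R n) F) X H W -> symmx W.
Proof.
move=> sX sH [tk [uk [tk0 [_ [ukc dom]]]]]; apply: symmx_cvg ukc => k.
have [+ _] := dom k; apply: symmx_of_scaled_sum.
  by rewrite gt_eqF // divr_gt0 // exprn_gt0.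
by apply: symmx_add => //; exact: symmx_scale.
Qed.
End SpectralTheorem.

Theorem theorem4p7 (R : realType) (n : nat) (theta : 'rV[R]_n -> \bar R)
    (X : 'M[R]_n) :
  sym_fun theta ->
  loc_lip_rel_dom [set: 'rV[R]_n] theta ->
  symmx X ->
  theta (eigvals X) \is a fin_num ->
  (forall H : 'M[R]_n,
     tangent_cone (efdom (@symmx R n) (theta \o @eigvals R n)) X H ->
     para_epi_for [set: 'rV[R]_n] theta (eigvals X) (eig_d1 X H) ->
     [/\ para_epi_for (@symmx R n) (theta \o @eigvals R n) X H,
         (forall W : 'M[R]_n, symmx W ->
            para_subderiv (@symmx R n) (theta \o @eigvals R n) X H W =
            para_subderiv [set: 'rV[R]_n] theta (eigvals X) (eig_d1 X H) (eig_d2 X H W)),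
         [set W | symmx W /\
            (para_subderiv (@symmx R n) (theta \o @eigvals R n) X H W < +oo)%E]
           = tangent2 (efdom (@symmx R n) (theta \o @eigvals R n)) X H
       & (lsc theta -> convex_on [set: 'rV[R]_n] theta ->
          convex_on (@symmx R n)
            (para_subderiv (@symmx R n) (theta \o @eigvals R n) X H))]) /\
  (para_epi (@symmx R n) (theta \o @eigvals R n) X ->
   para_epi [set: 'rV[R]_n] theta (eigvals X)).
Proof.
move=> symt lip sX fin.
have SD (a b : 'M[R]_n) : symmx a -> symmx b -> symmx (a + b) by exact: symmx_add.
have SZ (c : R) (a : 'M[R]_n) : symmx a -> symmx (c *: a) by exact: symmx_scale.
have Flip := spectral_loc_lip lip.
split.
  move=> H tH epi; have sH := tangent_cone_symmx sX tH.
  have Fepi := para_epi_for_spectral symt sX sH epi.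
  split.
  - exact: Fepi.
  - by move=> W sW; exact: para_subderiv_spectral.
  - apply/seteqP; split=> W.
      by move=> [sW]; apply: (para_dom_tangent2 SD SZ sX sH fin Fepi.1 sW).
    move=> tW; have sW := tangent2_symmx sX sH tW; split; first exact: sW.
    exact: (tangent2_para_dom SD SZ sX sH fin Flip Fepi sW tW).
  - move=> _ cvx; apply: (para_epi_convex SD SZ sX sH fin _ Fepi).
    exact: spectral_convex.
move=> Fepi w _ wfin.
(* Every direction [w] is a first-order eigenvalue derivative up to a permutation fixing
   [eigvals X], so the assumption on matrices reaches all directions of [theta]. *)
have [H [s [sH E0 E1]]] := eig_d1_surj w sX.
apply: (para_epi_for_col_perm symt (s := s)); rewrite E0 -E1.
apply: (para_epi_for_of_spectral symt sX sH); apply: Fepi => //.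
rewrite (subderiv_spectral symt sX sH) E1.
by have := subderiv_col_perm symt s (eigvals X) w; rewrite E0 => ->.
Qed.
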